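(* Let $I=[0,\infty)$ and let $w$ be a weight function on $I$. Let $\varphi$ and $\varphi_n$ ($n\ge1$) be Orlicz functions such that each $\varphi_n$ satisfies the $\Delta_\varphi(0)$-condition or the $\Delta_\varphi(\infty)$-condition. Then the set $(\Lambda_{\varphi,w})_a\setminus\bigcup_{n=1}^\infty\Lambda_{\varphi_n,w}$ is $\mathfrak{c}$-spaceable in $(\Lambda_{\varphi,w})_a$. Moreover, if $\varphi$ satisfies the $\Delta_2$-condition, then $\Lambda_{\varphi,w}\setminus\bigcup_{n=1}^\infty\Lambda_{\varphi_n,w}$ is maximal-spaceable in $\Lambda_{\varphi,w}$.
   Context: The interval $I=[0,\infty)$ carries Lebesgue measure $m$. $L_0$ is the space of real Lebesgue measurable functions on $I$ modulo a.e. equality. For $f\in L_0$, $d_f(\lambda)=m(\{t\in I:|f(t)|>\lambda\})$ for $\lambda>0$, and $f^*(t)=\inf\{\lambda>0:d_f(\lambda)\le t\}$ for $t\ge 0$ (with $\inf\varnothing=\infty$). An Orlicz function is a convex function $\varphi:[0,\infty)\to[0,\infty)$ with $\varphi(0)=0=\lim_{u\to0}\varphi(u)$ and $\varphi(u)>0$ for $u>0$ (put $\varphi(\infty)=\infty$). It satisfies the $\Delta_2^\infty$-condition if there are $K>2$, $u_0\ge0$ with $\varphi(2u)\le K\varphi(u)$ for all $u\ge u_0$; the $\Delta_2^0$-condition if there are $K>2$, $u_0>0$ with $\varphi(2u)\le K\varphi(u)$ for all $0\le u\le u_0$; the $\Delta_2$-condition if it satisfies both. An Orlicz function $\psi$ satisfies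 the $\Delta_\varphi(\infty)$-condition (respectively, the $\Delta_\varphi(0)$-condition) if for every $b>0$ there exists $u_0>0$ such that $\varphi(u)\le\psi(bu)$ for every $u\ge u_0$ (respectively, for every $0\le u\le u_0$). A weight function on $I$ is a positive, decreasing (i.e. nonincreasing) function $w:(0,\infty)\to(0,\infty)$ with $\int_0^t w<\infty$ for every $t>0$ and $\int_0^\infty w=\infty$. The modular is $\rho_{\varphi,w}(f)=\int_I\varphi(f^*(t))w(t)\,dt$. The Orlicz-Lorentz space is $\Lambda_{\varphi,w}=\{f\in L_0:\rho_{\varphi,w}(kf)<\infty\text{ for some }k>0\}$ with the Luxemburg norm $\|f\|_{\varphi,w}=\inf\{\varepsilon>0:\rho_{\varphi,w}(f/\varepsilon)\le1\}$ (a Banach space). $(\Lambda_{\varphi,w})_a$ is its closed subspace of order-continuous elements (those $f$ with $\|f_n\|_{\varphi,w}\downarrow0$ whenever $|f_n|\le|f|$ and $|f_n|\downarrow0$ a.e.); it is well known that $(\Lambda_{\varphi,w})_a=\{f\in L_0:\rho_{\varphi,w}(kf)<\infty\text{ for every }k>0\}$. $\mathfrak{c}$ is the cardinality of the continuum; $\dim$ is algebraic dimension. A subset $A$ of a topological vector space $X$ is $\alpha$-spaceable in $X$ ($\alpha$ a cardinal) if there is a closed $\alpha$-dimensional vector subspace $M$ of $X$ with $M\subset A\cup\{0\}$; it is maximal-spaceable if it is $\dim(X)$-spaceable. *)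

(* Defs.v *)
From HB Require Import structures.
From mathcomp Require Import all_boot all_order all_algebra.
From mathcomp Require Import all_classical all_reals all_analysis.
From mathcomp Require Import measurable_realfun.

Set Implicit Arguments.
Unset Strict Implicit.
Unset Printing Implicit Defensive.

Import Order.TTheory GRing.Theory Num.Theory.
Import numFieldNormedType.Exports.

Local Open Scope classical_set_scope.
Local Open Scope ring_scope.

(* The real line with the sigma-algebra of Lebesgue (Caratheodory) measurable
   sets, which is the domain of completed_lebesgue_measure. *)
Definition lebesgue_line (R : realType) : Type :=
  caratheodory_type (wlength (@idfun R))^*%mu.
HB.instance Definition _ (R : realType) := Pointed.on (lebesgue_line R).
HB.instance Definition _ (R : realType) := Measurable.on (lebesgue_line R).

Definition halfline (R : realType) : set (lebesgue_line R) :=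
  [set x : R | 0 <= x].

Lemma measurable_halfline (R : realType) : measurable (@halfline R).
Proof.
apply: sub_caratheodory.
have -> : @halfline R = `[0, +oo[%classic :> set R.
  by apply/seteqP; split=> x /=; rewrite in_itv /= andbT.
exact: (@measurable_itv R `[0, +oo[).
Qed.

Definition mI (R : realType) : set (lebesgue_line R) -> \bar R :=
  mrestr (@completed_lebesgue_measure R) (@measurable_halfline R).
HB.instance Definition _ (R : realType) := Measure.on (@mI R).

(* mathcomp-analysis leaves the quotient of measurable functions by a.e. equality
   without algebraic structure: endow it with the pointwise linear structure. *)
Section linear_aeEqMfun.
Context d (T : measurableType d) (R : realType).
Variable mu : {measure set T -> \bar R}.
Local Open Scope quotient_scope.
Local Notation Q := {mfun_ mu, T >-> R}.
Local Notation F := {mfun T >-> R}.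
Implicit Types (x y z : Q) (f g : F) (a b : R).

Definition aeq_add x y : Q := \pi_Q ((repr x : F) + (repr y : F)).
Definition aeq_opp x : Q := \pi_Q (- (repr x : F)).
Definition aeq_scale a x : Q := \pi_Q (a *: (repr x : F)).

Lemma aeq_piP f g :
  \pi_Q f = \pi_Q g <-> {ae mu, forall t, (f : T -> R) t = (g : T -> R) t}.
Proof.
split=> [/eqmodP/asboolP H|H]; last apply/eqmodP/asboolP.
- by apply: filterS H => t; apply.
- by apply: filterS H => t.
Qed.

Lemma aeq_repr_pi f :
  {ae mu, forall t, (repr (\pi_Q f) : T -> R) t = (f : T -> R) t}.
Proof. by apply/aeq_piP; rewrite reprK. Qed.

Lemma aeq_addE f g : aeq_add (\pi_Q f) (\pi_Q g) = \pi_Q (f + g).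
Proof.
apply/aeq_piP; apply: filterS2 (aeq_repr_pi f) (aeq_repr_pi g) => t ef eg.
exact: congr2 ef eg.
Qed.

Lemma aeq_oppE f : aeq_opp (\pi_Q f) = \pi_Q (- f).
Proof.
apply/aeq_piP; apply: filterS (aeq_repr_pi f) => t ef.
exact: congr1 ef.
Qed.

Lemma aeq_scaleE a f : aeq_scale a (\pi_Q f) = \pi_Q (a *: f).
Proof.
apply/aeq_piP; apply: filterS (aeq_repr_pi f) => t ef.
exact: congr1 ef.
Qed.

Lemma aeq_ind (P : Q -> Prop) : (forall f, P (\pi_Q f)) -> forall x, P x.
Proof. by move=> Pf x; rewrite -[x]reprK; exact: Pf. Qed.

Lemma aeq_addA : associative aeq_add.
Proof.
apply: aeq_ind => f; apply: aeq_ind => g; apply: aeq_ind => h.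
by rewrite !aeq_addE addrA.
Qed.

Lemma aeq_addC : commutative aeq_add.
Proof.
by apply: aeq_ind => f; apply: aeq_ind => g; rewrite !aeq_addE addrC.
Qed.

Lemma aeq_add0 : left_id (\pi_Q (0 : F)) aeq_add.
Proof. by apply: aeq_ind => f; rewrite aeq_addE add0r. Qed.

Lemma aeq_addN : left_inverse (\pi_Q (0 : F)) aeq_opp aeq_add.
Proof. by apply: aeq_ind => f; rewrite aeq_oppE aeq_addE addNr. Qed.

HB.instance Definition _ :=
  GRing.isZmodule.Build Q aeq_addA aeq_addC aeq_add0 aeq_addN.

Lemma aeq_scaleA a b x : aeq_scale a (aeq_scale b x) = aeq_scale (a * b) x.
Proof. by elim/aeq_ind: x => f; rewrite !aeq_scaleE scalerA. Qed.

Lemma aeq_scale1 : left_id 1 aeq_scale.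
Proof. by apply: aeq_ind => f; rewrite aeq_scaleE scale1r. Qed.

Lemma aeq_scaleDr : right_distributive aeq_scale +%R.
Proof.
move=> a; apply: aeq_ind => f; apply: aeq_ind => g.
change (aeq_scale a (aeq_add (\pi_Q f) (\pi_Q g)) =
  aeq_add (aeq_scale a (\pi_Q f)) (aeq_scale a (\pi_Q g))).
by rewrite !(aeq_addE, aeq_scaleE) scalerDr.
Qed.

Lemma aeq_scaleDl x : {morph aeq_scale^~ x : a b / a + b}.
Proof.
elim/aeq_ind: x => f a b.
change (aeq_scale (a + b) (\pi_Q f) =
  aeq_add (aeq_scale a (\pi_Q f)) (aeq_scale b (\pi_Q f))).
by rewrite !(aeq_addE, aeq_scaleE) scalerDl.
Qed.

HB.instance Definition _ := GRing.Zmodule_isLmodule.Build R Q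
  aeq_scaleA aeq_scale1 aeq_scaleDr aeq_scaleDl.
End linear_aeEqMfun.

(* Functions on the whole line modulo a.e. equality with respect to mI, which
   ignores negative numbers: this is L_0 of the half-line. *)
Notation L0 R := {mfun_ (mI (R := R)), lebesgue_line R >-> R}.

Section linear_dimension.
Context (R : realType) (V : lmodType R).
Implicit Types (M X A B : set V).

Definition lin_independent B : Prop :=
  forall (s : seq V) (c : V -> R), uniq s -> (forall v, v \in s -> B v) ->
    \sum_(v <- s) c v *: v = 0 -> forall v, v \in s -> c v = 0.

Definition lin_span B : set V :=
  [set u | exists (s : seq V) (c : V -> R),
    (forall v, v \in s -> B v) /\ u = \sum_(v <- s) c v *: v].

Definition hamel_basis M B : Prop := lin_independent B /\ lin_span B = M.

(* The cardinal alpha is represented by any set A of that cardinality. *)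
Definition has_dim T M (A : set T) : Prop := exists2 B, hamel_basis M B & (B #= A)%card.

(* Closedness for the norm topology, spelled out because V is only equipped with
   a gauge: N is an extended-real-valued norm on V, finite on the subspace X, and M is
   relatively closed in the normed space (X, N). *)
Definition norm_closed_in (N : V -> \bar R) X M : Prop :=
  forall f, X f -> (forall e : R, 0 < e -> exists2 g, M g & (N (f - g)%R < e%:E)%E) ->
    M f.

Definition spaceable T (N : V -> \bar R) X A (alpha : set T) : Prop :=
  exists M : set V, [/\ M `<=` X, submod_closed (mem M), norm_closed_in N X M,
    has_dim M alpha & M `<=` A `|` [set 0]].

Definition maximal_spaceable (N : V -> \bar R) X A : Prop :=
  exists2 D : set V, hamel_basis X D & spaceable N X A D.
End linear_dimension.

Section orlicz_lorentz.
Context (R : realType).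
Implicit Types (phi psi w : R -> R) (f : L0 R).

(* Orlicz functions are only relevant on [0, +oo[, and weights on ]0, +oo[. *)
Definition orlicz_function phi : Prop :=
  [/\ forall u : R, 0 <= u -> 0 <= phi u,
      @convex_function R R^o `[0, +oo[ phi,
      phi 0 = 0,
      phi @ 0^'+ --> (0 : R) &
      forall u : R, 0 < u -> 0 < phi u].

Definition Delta2_infty phi : Prop :=
  exists2 K : R, 2 < K & exists2 u0 : R, 0 <= u0 &
    forall u : R, u0 <= u -> phi (2 * u) <= K * phi u.

Definition Delta2_zero phi : Prop :=
  exists2 K : R, 2 < K & exists2 u0 : R, 0 < u0 &
    forall u : R, 0 <= u <= u0 -> phi (2 * u) <= K * phi u.

Definition Delta2 phi : Prop := Delta2_infty phi /\ Delta2_zero phi.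

Definition Delta_rel_infty phi psi : Prop :=
  forall b : R, 0 < b -> exists2 u0 : R, 0 < u0 &
    forall u : R, u0 <= u -> phi u <= psi (b * u).

Definition Delta_rel_zero phi psi : Prop :=
  forall b : R, 0 < b -> exists2 u0 : R, 0 < u0 &
    forall u : R, 0 <= u <= u0 -> phi u <= psi (b * u).

Definition weight_function w : Prop :=
  [/\ forall t : R, 0 < t -> 0 < w t,
      forall s t : R, 0 < s -> s <= t -> w t <= w s,
      forall t : R, 0 < t ->
        (\int[lebesgue_measure]_(s in `]0%R, t]) (w s)%:E < +oo)%E &
      (\int[lebesgue_measure]_(s in `]0%R, +oo[) (w s)%:E = +oo)%E].

Definition distribution_function f (l : R) : \bar R :=
  mI [set t | l < `|f t|].

Definition decreasing_rearrangement f (t : R) : \bar R :=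
  ereal_inf [set l%:E | l in [set l : R |
    0 < l /\ (distribution_function f l <= t%:E)%E]].

Definition extend_infty phi (x : \bar R) : \bar R :=
  match x with
  | r%:E => (phi r)%:E
  | +oo%E => +oo%E
  | -oo%E => 0%E
  end.

(* The integrand is the product of a monotone function of t and w, hence Borel,
   so that integrating against the Borel Lebesgue measure is enough; 0 is left
   out because w is not defined there. *)
Definition modular phi w f : \bar R :=
  (\int[lebesgue_measure]_(t in `]0%R, +oo[)
     (extend_infty phi (decreasing_rearrangement f t) * (w t)%:E))%E.

Definition orlicz_lorentz phi w : set (L0 R) :=
  [set f | exists2 k : R, 0 < k & (modular phi w (k *: f)%R < +oo)%E].

Definition luxemburg_norm phi w f : \bar R :=
  ereal_inf [set e%:E | e in [set e : R |
    0 < e /\ (modular phi w (e^-1 *: f)%R <= 1)%E]].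

Definition orlicz_lorentz_oc phi w : set (L0 R) :=
  [set f | orlicz_lorentz phi w f /\
    forall F : nat -> L0 R,
      (forall n, {ae mI (R := R), forall t, `|F n t| <= `|f t|}) ->
      {ae mI (R := R), forall t, nonincreasing_seq (fun n => `|F n t|) /\
        (fun n => `|F n t|) @ \oo --> (0 : R)} ->
      nonincreasing_seq (fun n => luxemburg_norm phi w (F n)) /\
      (fun n => luxemburg_norm phi w (F n)) @ \oo --> 0%E].
End orlicz_lorentz.

(* Main.v *)
Require Import Defs.
From HB Require Import structures.
From mathcomp Require Import all_boot all_order all_algebra.
From mathcomp Require Import all_classical all_reals all_analysis.
From mathcomp Require Import measurable_realfun.
From mathcomp Require Import ring lra.
Import Order.TTheory GRing.Theory Num.Theory.
Import numFieldNormedType.Exports.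
Local Open Scope classical_set_scope.
Local Open Scope ring_scope.

(** Write W(t) for the integral of w over ]0, t[.  A condition on phi_ n, at 0
or at infinity, provides for all b, C > 0 a point u > 0 with
phi (C u) <= phi_ n (b u): this is all that the proof uses of it
([domination_point]).  So there are heights u at which phi_ n, even at a small
multiple of u, is much larger than phi at a large multiple of u.  Since W takes
arbitrarily small and arbitrarily large values, such a height can be given a
length m for which phi_ n (u / (i + 1)) W(m) >= i + 1 although
phi ((j + 1) u) W(m) is tiny ([good_layer]).

The layers j are indexed by triples (k, n, i), coded as natural numbers.  They
are placed on disjoint intervals E_j of length m_j.  For a sequence a of reals,
the layered function of a takes the value a_k u_j on each E_j with
j = (k, n, i).  If some a_k is not 0, Chebyshev's inequality on the layers
(k, n, i), for i large, makes the modular of phi_ n infinite at every multiple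
of the function, for every n ([layered_space_notin]).  The modular of phi, on
the contrary, is finite at every multiple if a is bounded: a modular is at most
a weighted sum over the layers ([rho_layers]), because the rearrangement at t
does not exceed l unless some layer higher than l has length more than
2 ^ - (j + 1) t.

The subspace M consists of all layered functions whose multiples all have a
finite modular.  By dominated convergence these are order continuous
([order_continuous_of_modular]).  M is a vector space because
(f + g)^*(2 t) <= max ((2 f)^*(t), (2 g)^*(t)), and a dilation by 2 costs a
factor 2 at most in the modular ([rho_subadd]).  M is closed because
convergence in norm implies convergence in measure ([luxemburg_distr]), and a
limit in measure of multiples of a constant on E_j is again one, the multiples
of a common block k converging to a common limit ([layered_limit]).

For the dimension, the sequences (r ^ k)_k with r in ]-1, 1[ are bounded and,
by the Vandermonde argument, independent; so M contains an independent family
indexed by the reals, which extends to a Hamel basis of M and to one of the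
Orlicz-Lorentz space.  Conversely the whole of L_0 injects into the reals
([card_L0]).  By the Cantor-Bernstein theorem both bases have the cardinality of
the continuum, and M answers both questions. *)

Set Implicit Arguments.
Unset Strict Implicit.
Unset Printing Implicit Defensive.

(** * Orlicz functions *)

Lemma ge0_cvge0 (R : realType) (x : nat -> \bar R) : (forall n, 0 <= x n)%E ->
  (forall e : R, 0 < e -> \forall n \near \oo, (x n <= e%:E)%E) ->
  x @ \oo --> 0%E.
Proof.
move=> x0 H; apply/fine_cvgP; split.
  apply: filterS (H 1 ltr01) => n xn1.
  by rewrite ge0_fin_numE//; apply: le_lt_trans xn1 _; rewrite ltry.
apply/cvgr0Pnorm_le => e e0; apply: filterS (H e e0) => n xne /=.
have xf : x n \is a fin_num.
  by rewrite ge0_fin_numE//; apply: le_lt_trans xne _; rewrite ltry.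
by rewrite ger0_norm ?fine_ge0// -lee_fin fineK.
Qed.

Section orlicz.
Context (R : realType) (phi : R -> R) (ophi : orlicz_function phi).

Lemma orlicz_ge0 u : 0 <= u -> 0 <= phi u.
Proof. by case: ophi => + _ _ _ _; apply. Qed.

Lemma orlicz_shrink a u : 0 <= a <= 1 -> 0 <= u -> phi (a * u) <= a * phi u.
Proof.
move=> /andP[a0 a1] u0; case: ophi => _ cvx phi0 _ _.
have := cvx (Itv01 a0 a1) u 0; rewrite !inE /= !in_itv /= !andbT lexx u0.
move=> /(_ isT isT) H.
have : phi (a * u + (1 - a) * 0) <= a * phi u + (1 - a) * phi 0 by exact: H.
by rewrite phi0 !mulr0 !addr0.
Qed.

Lemma orlicz_le u v : 0 <= u -> u <= v -> phi u <= phi v.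
Proof.
move=> u0 uv; have v0 := le_trans u0 uv.
have [vE|v_neq0] := eqVneq v 0.
  by rewrite vE; have -> : u = 0 by apply/eqP; rewrite eq_le u0 andbT -vE.
have vgt0 : 0 < v by rewrite lt_neqAle eq_sym v_neq0.
have uvE : u = (u / v) * v by rewrite divfK.
have uv1 : 0 <= u / v <= 1 by rewrite divr_ge0//= ler_pdivrMr// mul1r.
rewrite uvE; apply: le_trans (orlicz_shrink uv1 v0) _.
by rewrite ler_piMl ?orlicz_ge0//; case/andP: uv1.
Qed.

Lemma orlicz_expand a u : 1 <= a -> 0 <= u -> a * phi u <= phi (a * u).
Proof.
move=> a1 u0; have a0 : 0 < a by apply: lt_le_trans a1.
rewrite -ler_pdivlMl//.
have -> : phi u = phi (a^-1 * (a * u)) by rewrite mulKf// gt_eqF.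
apply: orlicz_shrink; last by rewrite mulr_ge0// ltW.
by rewrite invr_ge0 ltW//= invf_le1.
Qed.

Lemma orlicz_gt0 u : 0 < u -> 0 < phi u.
Proof. by case: ophi => _ _ _ _; apply. Qed.

Lemma orlicz0 : phi 0 = 0.
Proof. by case: ophi. Qed.

Lemma orlicz_unbounded y : exists2 u, 0 < u & y < phi u.
Proof.
have p1 := orlicz_gt0 ltr01.
exists (`|y| / phi 1 + 1); first by rewrite ltr_wpDl// divr_ge0// ltW.
have a1 : 1 <= `|y| / phi 1 + 1 by rewrite lerDr divr_ge0// ltW.
rewrite -[X in phi X]mulr1.
apply: lt_le_trans (orlicz_expand a1 ler01).
rewrite mulrDl mul1r divfK ?gt_eqF//.
by apply: le_lt_trans (ler_norm y) _; rewrite ltrDl.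
Qed.

Lemma extend_infty_ge0 x : (0 <= x)%E -> (0 <= extend_infty phi x)%E.
Proof. by case: x => //= r; rewrite !lee_fin; exact: orlicz_ge0. Qed.

Lemma le_extend_infty x y : (0 <= x)%E -> (x <= y)%E ->
  (extend_infty phi x <= extend_infty phi y)%E.
Proof.
case: x => [r| |]//; case: y => [s| |]//=.
- by rewrite !lee_fin; exact: orlicz_le.
- by move=> *; rewrite leey.
Qed.

Lemma extend_infty_cvg0 (x : nat -> \bar R) : (forall n, 0 <= x n)%E ->
  (forall e : R, 0 < e -> \forall n \near \oo, (x n <= e%:E)%E) ->
  (fun n => extend_infty phi (x n)) @ \oo --> 0%E.
Proof.
move=> x0 xe; apply: ge0_cvge0 => [n|e e0]; first exact: extend_infty_ge0.
pose a := Num.min 1 (e / phi 1).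
have p1 := orlicz_gt0 ltr01.
have a0 : 0 < a by rewrite lt_min ltr01 divr_gt0.
apply: filterS (xe a a0) => n xna.
apply: le_trans (le_extend_infty (x0 n) xna) _ => /=.
rewrite lee_fin -[a]mulr1; apply: le_trans (orlicz_shrink _ ler01) _.
  by rewrite ltW//= ge_min lexx.
by rewrite -ler_pdivlMr// ge_min lexx orbT.
Qed.

End orlicz.

(** * Dilations of the line and primitives of a weight *)

(** The superlevel sets of a monotone function on an interval are intervals. *)
Lemma nonincreasing_measurableE (R : realType) (D : set R) (F : R -> \bar R) :
  is_interval D ->
  (forall s t, D s -> D t -> s <= t -> (F t <= F s)%E) -> measurable_fun D F.
Proof.
move=> iD niF; apply: (measurability _ (ErealGenOInfty.measurableE R)).
move=> _ [_ [y ->] <-]; apply: is_interval_measurable => s t/=.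
rewrite !in_itv /= !andbT => -[Ds Fs] [Dt Ft] r srt.
have Dr : D r by apply: iD srt.
split=> //=; rewrite in_itv /= andbT; apply: lt_le_trans Ft _; apply: niF => //.
by case/andP: srt.
Qed.

Section scaling.
Context (R : realType) (c : R) (c0 : 0 < c).
Notation mu := (@lebesgue_measure R).

Let scale : measurableTypeR R -> measurableTypeR R := fun s : R => c * s.

Let measurable_scale : measurable_fun setT scale.
Proof. exact: (@measurable_funM _ _ _ _ (cst c) id). Qed.

Let push : {measure set (measurableTypeR R) -> \bar R} :=
  measure_function_pushforward__canonical__measure_function_Measure
    mu measurable_scale.

(** Both sides are measures on the Borel sets, so it is enough to compare them on
bounded intervals. *)
Lemma lebesgue_measure_scale (A : set R) : measurable A ->
  mu A = mscale (NngNum (ltW c0)) push A.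
Proof.
apply: lebesgue_measure_unique => _ [[a b]] _ <-.
have preE : scale @^-1` `]a, b] = `](c^-1 * a), (c^-1 * b)]%classic.
  apply/seteqP; split=> x /=; rewrite !in_itv /= /scale.
  - by rewrite ltr_pdivrMl// ler_pdivlMl.
  - by rewrite ltr_pdivrMl// ler_pdivlMl.
change (mu `]a, b] = c%:E * mu (scale @^-1` `]a, b]))%E.
rewrite preE !lebesgue_measure_itv /= !lte_fin ltr_pM2l ?invr_gt0//.
case: ifPn => _; last by rewrite mule0.
by rewrite -EFinD -EFinM; congr EFin; field; rewrite gt_eqF.
Qed.

Lemma ge0_integral_scale (D : set R) (g : R -> \bar R) : measurable D ->
  measurable_fun D g -> (forall t, D t -> (0 <= g t)%E) ->
  (\int[mu]_(t in D) g t =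
   c%:E * \int[mu]_(t in (fun s => c * s)%R @^-1` D) g (c * t)%R)%E.
Proof.
move=> mD mg g0.
rewrite (eq_measure_integral (mscale (NngNum (ltW c0)) push)).
  rewrite ge0_integral_mscale//=; congr (_ * _)%E.
  rewrite ge0_integral_pushforward//= => t; rewrite inE; exact: g0.
by move=> A mA _; exact: lebesgue_measure_scale.
Qed.
End scaling.

Section weight.
Context (R : realType) (w : R -> R) (hw : weight_function w).
Notation mu := (@lebesgue_measure R).

(** The interval is open on the right because f^* >= l holds on [0, t[, and may
fail at t, when the distribution function of f at l is t. *)
Definition weight_primitive (t : R) : \bar R :=
  (\int[mu]_(s in `]0%R, t[) (w s)%:E)%E.
Notation W := weight_primitive.

Lemma weight_gt0 t : 0 < t -> 0 < w t.
Proof. by case: hw => + _ _ _; apply. Qed.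

Lemma weight_ge0 t : 0 < t -> (0 <= (w t)%:E)%E.
Proof. by move=> t0; rewrite lee_fin ltW// weight_gt0. Qed.

Lemma weight_nincr s t : 0 < s -> s <= t -> w t <= w s.
Proof. by case: hw => _ + _ _; apply. Qed.

Lemma measurable_weight :
  measurable_fun (`]0%R, +oo[%classic : set R) (EFin \o w).
Proof.
apply: nonincreasing_measurableE; first exact: interval_is_interval.
move=> s t /=; rewrite !in_itv /= !andbT lee_fin => s0 _; exact: weight_nincr.
Qed.

Lemma measurable_weightS (D : set R) : D `<=` `]0%R, +oo[ ->
  measurable_fun D (EFin \o w).
Proof. by move=> DS; apply: measurable_funS measurable_weight. Qed.

Lemma le_weight_primitive s t : s <= t -> (W s <= W t)%E.
Proof.
move=> st; apply: ge0_subset_integral => //.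
- by apply: measurable_weightS => x /=; rewrite !in_itv /= => /andP[->].
- by move=> x /=; rewrite in_itv /= => /andP[? _]; exact: weight_ge0.
- move=> x /=; rewrite !in_itv /= => /andP[-> /= xs]; exact: lt_le_trans st.
Qed.

Lemma weight_primitive_lty t : (W t < +oo)%E.
Proof.
have t1 : 0 < Num.max t 1 by rewrite lt_max ltr01 orbT.
have [_ _ /(_ _ t1) + _] := hw; apply: le_lt_trans.
apply: ge0_subset_integral => //.
- by apply: measurable_weightS => x /=; rewrite !in_itv /= => /andP[->].
- by move=> x /=; rewrite in_itv /= => /andP[? _]; exact: weight_ge0.
- move=> x /=; rewrite !in_itv /= => /andP[-> /= xs].
  by rewrite le_max ltW.
Qed.

Lemma weight_primitive_ge0 t : (0 <= W t)%E.
Proof.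
apply: integral_ge0 => x /=; rewrite in_itv /= => /andP[? _]; exact: weight_ge0.
Qed.

Lemma weight_primitive_fin t : W t \is a fin_num.
Proof. by rewrite ge0_fin_numE ?weight_primitive_ge0 ?weight_primitive_lty. Qed.

Lemma weight_primitive_gt0 t : 0 < t -> (0 < W t)%E.
Proof.
move=> t0; apply: (@lt_le_trans _ _ (\int[mu]_(s in `]0%R, t[) (w t)%:E)%E).
  rewrite integral_cst//= lebesgue_measure_itv /= lte_fin t0 -EFinB subr0.
  by rewrite -EFinM lte_fin mulr_gt0// weight_gt0.
apply: ge0_le_integral => //=.
- by move=> x _; rewrite weight_ge0.
- by apply: measurable_weightS => x /=; rewrite !in_itv /= => /andP[->].
- move=> x /=; rewrite in_itv /= lee_fin => /andP[x0 /ltW]; exact: weight_nincr.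
Qed.

(** Substitute s = 2 s' and use that w is nonincreasing: w (2 s') <= w s'. *)
Lemma weight_primitive_double t : 0 < t -> (W (2 * t) <= 2%:E * W t)%E.
Proof.
move=> t0.
rewrite /W (ge0_integral_scale (@ltr0n R 2))//; last 2 first.
- by apply: measurable_weightS => x /=; rewrite !in_itv /= => /andP[->].
- by move=> x /=; rewrite in_itv /= => /andP[? _]; exact: weight_ge0.
rewrite (_ : _ @^-1` _ = `]0%R, t[%classic); last first.
  apply/seteqP; split=> x /=; rewrite !in_itv /=.
    by rewrite pmulr_rgt0// ltr_pM2l.
  by rewrite pmulr_rgt0// ltr_pM2l.
rewrite lee_pmul2l//; apply: ge0_le_integral => //=.
- move=> x; rewrite /= in_itv /= => /andP[x0 _].
  by rewrite weight_ge0// mulr_gt0.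
- apply: nonincreasing_measurableE; first exact: interval_is_interval.
  move=> r s /=; rewrite !in_itv /= lee_fin => /andP[r0 _] _ rs.
  by apply: weight_nincr; rewrite ?mulr_gt0// ler_pM2l.
- by apply: measurable_weightS => x /=; rewrite !in_itv /= => /andP[->].
- move=> x; rewrite /= in_itv /= lee_fin => /andP[x0 _].
  by apply: weight_nincr => //; rewrite ler_peMl ?ler1n// ltW.
Qed.

Lemma weight_primitive_pow2 n t : 0 < t ->
  (W (2 ^+ n * t) <= (2 ^+ n)%:E * W t)%E.
Proof.
move=> t0; elim: n => [|n IH]; first by rewrite expr0 mul1r mul1e.
rewrite exprS -mulrA; apply: le_trans (weight_primitive_double _) _.
  by rewrite mulr_gt0// exprn_gt0.
by rewrite EFinM -muleA lee_pmul2l.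
Qed.

(** Monotone convergence on the intervals [1/(n+1), 1[ exhausts the mass of
]0, 1[, so what remains near 0 is small. *)
Lemma weight_primitive_small y : 0 < y -> exists2 t, 0 < t & (W t <= y%:E)%E.
Proof.
move=> y0.
pose F (n : nat) := `[n.+1%:R^-1 : R, 1[%classic.
have n0 n : 0 < n.+1%:R^-1 :> R by rewrite invr_gt0.
have FS n : F n `<=` `]0%R, +oo[.
  move=> x /=; rewrite /F /= !in_itv /= andbT => /andP[+ _].
  exact: lt_le_trans.
have wF0 n x : F n x -> (0 <= (EFin \o w) x)%E.
  by move=> /FS /=; rewrite in_itv /= andbT; exact: weight_ge0.
have ndF : nondecreasing_seq F.
  move=> m n mn; apply/subsetPset => x.
  rewrite /F /= !in_itv /= => /andP[mx ->].
  by rewrite andbT (le_trans _ mx)// lef_pV2 ?posrE// ler_nat.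
have := ge0_nondecreasing_set_cvg_integral (mu := mu) ndF
  (fun=> measurable_itv _) (fun n => measurable_weightS (@FS n)) wF0.
have -> : \bigcup_i F i = `]0%R, 1[%classic.
  apply/seteqP; split=> x /=.
    move=> [n _]; rewrite /F /= !in_itv /= => /andP[+ ->]; rewrite andbT.
    exact: lt_le_trans.
  rewrite in_itv /= => /andP[x0 x1]; exists (Num.truncn x^-1) => //.
  rewrite /F /= in_itv /= x1 andbT invf_ple ?posrE// ltW//.
  by rewrite truncnS_gt.
move=> cvgW.
have lt1 : (W 1 - y%:E < W 1)%E.
  by rewrite -(fineK (weight_primitive_fin 1)) -EFinB lte_fin ltrBlDr ltrDl.
have [n _ /(_ n (leqnn n)) /= Hn] := cvgW _
  (open_nbhs_nbhs (conj (@open_ereal_gt_ereal _ _) lt1)).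
exists n.+1%:R^-1 => //.
have n1 : n.+1%:R^-1 <= 1 :> R by rewrite invf_le1 ?ler1n.
have WE : (W 1 = W n.+1%:R^-1 + \int[mu]_(x in F n) (w x)%:E)%E.
  rewrite /W -ge0_integral_setU//=.
  - congr (\int[mu]_(x in _) _)%E; apply/seteqP; split=> x.
    + rewrite /F /= !in_itv /= => /andP[-> x1].
      by have [xn|xn] := ltP x n.+1%:R^-1; [left|right].
    + rewrite /F /= !in_itv /= => -[/andP[-> /= xn]|/andP[xn ->]].
        exact: lt_le_trans n1.
      by rewrite andbT; exact: lt_le_trans xn.
  - exact: measurable_itv.
  - apply: measurable_weightS => x [|/FS//] /=.
    by rewrite !in_itv /= => /andP[->].
  - move=> x [|/wF0//] /=; rewrite in_itv /= => /andP[? _]; exact: weight_ge0.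
  - apply/disj_setPS => x [] /=; rewrite /F /= !in_itv /=.
    move=> /andP[_ xn] /andP[+ _].
    by rewrite leNgt xn.
have Ifin : (\int[mu]_(x in F n) (w x)%:E)%E \is a fin_num.
  have := weight_primitive_fin 1; rewrite WE fin_numD => /andP[_ //].
move: Hn; rewrite {1}WE -(fineK Ifin).
rewrite -(fineK (weight_primitive_fin n.+1%:R^-1)).
by rewrite -!EFinD lte_fin lee_fin; lra.
Qed.

Lemma weight_primitive_large y : exists2 t, 0 < t & (y%:E < W t)%E.
Proof.
pose F (n : nat) := `]0%R, n.+1%:R : R[%classic.
have FS n : F n `<=` `]0%R, +oo[.
  by move=> x /=; rewrite /F /= !in_itv /= andbT => /andP[].
have wF0 n x : F n x -> (0 <= (EFin \o w) x)%E.
  by move=> /FS /=; rewrite in_itv /= andbT; exact: weight_ge0.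
have ndF : nondecreasing_seq F.
  move=> m n mn; apply/subsetPset => x.
  rewrite /F /= !in_itv /= => /andP[-> /=].
  by move=> /lt_le_trans; apply; rewrite ler_nat.
have := ge0_nondecreasing_set_cvg_integral (mu := mu) ndF
  (fun=> measurable_itv _) (fun n => measurable_weightS (@FS n)) wF0.
have -> : \bigcup_i F i = `]0%R, +oo[%classic.
  apply/seteqP; split=> x /=; first by move=> [n _]; exact: FS.
  rewrite in_itv /= andbT => x0; exists (Num.truncn x) => //.
  by rewrite /F /= in_itv /= x0 truncnS_gt.
have [_ _ _ ->] := hw => /cvgey_gt /(_ y)[n _ /(_ n (leqnn n)) /= Hn].
by exists n.+1%:R.
Qed.

(** A substitute for the intermediate value theorem, good up to a factor 2: just
below the supremum of the t with W(t) <= y, pass from t to 2 t. *)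
Lemma weight_primitive_approx y : 0 < y ->
  exists2 t, 0 < t & (y%:E <= W t <= (2 * y)%:E)%E.
Proof.
move=> y0.
pose S := [set t | 0 < t /\ (W t <= y%:E)%E].
have [t0 t0gt0 Wt0] := weight_primitive_small y0.
have [t1 t1gt0 Wt1] := weight_primitive_large y.
have supS : has_sup S.
  split; first by exists t0.
  exists t1 => t [_ Wt]; rewrite leNgt; apply/negP => /ltW /le_weight_primitive.
  by move=> /(lt_le_trans Wt1); rewrite ltNge Wt.
have supS0 : 0 < sup S.
  apply: (lt_le_trans t0gt0).
  apply: (sup_upper_bound supS).
  by split.
have [s [s0 Ws] sS] := sup_adherent (divr_gt0 supS0 (@ltr0n R 2)) supS.
exists (2 * s); first by rewrite mulr_gt0.
apply/andP; split.
  have [//|/ltW W2] := leP y%:E (W (2 * s)).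
  have : 2 * s <= sup S.
    by apply: (sup_upper_bound supS); split; first by rewrite mulr_gt0.
  by lra.
apply: le_trans (weight_primitive_double s0) _.
by rewrite EFinM lee_pmul2l.
Qed.

End weight.

(** * Rearrangements and modulars *)

(** Instance search does not see the measure behind the bare set function [mI]. *)
#[local] Instance ae_mI_filter (R : realType) :
  Filter (nbhs (almost_everywhere (@mI R))).
Proof. exact: ae_filter_ringOfSetsType. Qed.

(** [mI] is the trace of an outer measure on the half-line, so that monotonicity and
subadditivity hold for arbitrary sets. *)
Section outer.
Context (R : realType).
Implicit Types A B : set (lebesgue_line R).

Lemma mI_le A B : A `<=` B -> (mI A <= mI B)%E.
Proof. by move=> AB; apply: le_outer_measure => x [/AB]. Qed.

Lemma mI_U A B : (mI (A `|` B) <= mI A + mI B)%E.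
Proof. by rewrite /mI /mrestr setIUl; exact: outer_measureU2. Qed.

Lemma mI_bigcup (F : nat -> set (lebesgue_line R)) :
  (mI (\bigcup_n F n) <= \sum_(n <oo) mI (F n))%E.
Proof.
rewrite /mI /mrestr setI_bigcupl; exact: outer_measure_sigma_subadditive.
Qed.

Lemma mI_le_ae A B : {ae mI (R := R), forall t, A t -> B t} -> (mI A <= mI B)%E.
Proof.
move=> [N [mN N0 ABN]]; rewrite -[leRHS]adde0 -N0.
apply: le_trans (mI_U _ _); apply: mI_le => t At.
by have [Bt|nBt] := pselect (B t); [left|right; apply: ABN => /(_ At)].
Qed.

End outer.

Section rearrangement.
Context (R : realType).
Implicit Types (h g : lebesgue_line R -> R) (l t : R).
Notation mu := (@lebesgue_measure R).

(** The three notions below repeat those for classes at the level of functions,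
because the class of a sum or of a multiple agrees with the sum or multiple of
representatives only almost everywhere. *)
Definition distr h l : \bar R := mI [set t | l < `|h t|].

Definition rearr h t : \bar R :=
  ereal_inf [set l%:E | l in [set l : R | 0 < l /\ (distr h l <= t%:E)%E]].

Definition rho (phi w : R -> R) h : \bar R :=
  (\int[mu]_(t in `]0%R, +oo[) (extend_infty phi (rearr h t) * (w t)%:E))%E.

Lemma modularE phi w (f : L0 R) : modular phi w f = rho phi w f.
Proof. by []. Qed.

Lemma rearr_ge0 h t : (0 <= rearr h t)%E.
Proof. by apply: le_ereal_inf_tmp => _ [l [l0 _] <-]; rewrite lee_fin ltW. Qed.

Lemma rearr_le h t l : 0 < l -> (distr h l <= t%:E)%E -> (rearr h t <= l%:E)%E.
Proof. by move=> l0 dl; apply: ereal_inf_lbound; exists l. Qed.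

Lemma rearr_lt h t x : (rearr h t < x)%E ->
  exists l, [/\ 0 < l, (distr h l <= t%:E)%E & (l%:E < x)%E].
Proof. by move=> /ereal_inf_lt[_ [l [l0 dl] <-] lx]; exists l. Qed.

Lemma rearr_nincr h s t : s <= t -> (rearr h t <= rearr h s)%E.
Proof.
move=> st; apply: ereal_inf_le_tmp => _ [l [l0 dl] <-]; exists l => //.
by split=> //; apply: le_trans dl _; rewrite lee_fin.
Qed.

Lemma le_rearr h1 h2 t : (forall l, 0 < l -> (distr h1 l <= distr h2 l)%E) ->
  (rearr h1 t <= rearr h2 t)%E.
Proof.
move=> h12; apply: ereal_inf_le_tmp => _ [l [l0 dl] <-]; exists l => //.
by split=> //; apply: le_trans (h12 _ l0) dl.
Qed.

Lemma distr_nincr h k l : k <= l -> (distr h l <= distr h k)%E.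
Proof. by move=> kl; apply: mI_le => t /=; exact: le_lt_trans. Qed.

(** If both distribution functions are at most t at l, then that of h is at most
2 t at l. *)
Lemma rearr_add h h1 h2 t :
  (forall l, 0 < l -> (distr h l <= distr h1 l + distr h2 l)%E) ->
  (rearr h (2 * t) <= maxe (rearr h1 t) (rearr h2 t))%E.
Proof.
move=> hh; rewrite leNgt; apply/negP; rewrite gt_max => /andP[].
move=> /rearr_lt[l1 [l10 d1 lt1]] /rearr_lt[l2 [l20 d2 lt2]].
have l0 : 0 < Num.max l1 l2 by rewrite lt_max l10.
suff : (rearr h (2 * t) <= (Num.max l1 l2)%:E)%E.
  by rewrite leNgt EFin_max gt_max lt1 lt2.
apply: rearr_le => //; apply: le_trans (hh _ l0) _.
rewrite mulr_natl mulr2n EFinD leeD//.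
  by apply: le_trans d1; apply: distr_nincr; rewrite le_max lexx.
by apply: le_trans d2; apply: distr_nincr; rewrite le_max lexx orbT.
Qed.

Lemma rearr_ge h t t0 l : 0 < l -> t < t0 -> (t0%:E <= distr h l)%E ->
  (l%:E <= rearr h t)%E.
Proof.
move=> l0 tt0 dl; apply: le_ereal_inf_tmp => _ [k [k0 dk] <-].
rewrite lee_fin leNgt; apply/negP => /ltW /(distr_nincr h).
move=> /(le_trans dl) /le_trans /(_ dk); rewrite lee_fin leNgt.
by rewrite tt0.
Qed.

Section orlicz.
Variables (phi w : R -> R).
Hypotheses (ophi : orlicz_function phi) (hw : weight_function w).
Notation rho := (rho phi w).

Lemma modular_integrand_ge0 h t : 0 < t ->
  (0 <= extend_infty phi (rearr h t) * (w t)%:E)%E.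
Proof.
move=> t0; rewrite mule_ge0// ?(weight_ge0 hw)//.
by apply: extend_infty_ge0 => //; exact: rearr_ge0.
Qed.

Lemma modular_integrand_nincr h s t : 0 < s -> s <= t ->
  (extend_infty phi (rearr h t) * (w t)%:E <=
   extend_infty phi (rearr h s) * (w s)%:E)%E.
Proof.
move=> s0 st; have t0 := lt_le_trans s0 st; apply: lee_pmul.
- by apply: extend_infty_ge0 => //; exact: rearr_ge0.
- exact: weight_ge0.
- by apply: le_extend_infty => //; [exact: rearr_ge0|exact: rearr_nincr].
- by rewrite lee_fin; exact: weight_nincr.
Qed.

Lemma measurable_modular_integrand h :
  measurable_fun (`]0%R, +oo[%classic : set R)
  (fun t => extend_infty phi (rearr h t) * (w t)%:E)%E.
Proof.
apply: nonincreasing_measurableE; first exact: interval_is_interval.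
move=> s t /=; rewrite !in_itv /= !andbT => s0 _.
exact: modular_integrand_nincr.
Qed.

Lemma rho_ge0 h : (0 <= rho h)%E.
Proof.
apply: integral_ge0 => t /=; rewrite in_itv /= andbT.
exact: modular_integrand_ge0.
Qed.

Lemma le_rho h1 h2 : (forall l, 0 < l -> (distr h1 l <= distr h2 l)%E) ->
  (rho h1 <= rho h2)%E.
Proof.
move=> h12; apply: ge0_le_integral => //.
- by move=> t /=; rewrite in_itv /= andbT; exact: modular_integrand_ge0.
- exact: measurable_modular_integrand.
- exact: measurable_modular_integrand.
- move=> t /=; rewrite in_itv /= andbT => t0.
  rewrite lee_wpmul2r ?(weight_ge0 hw)//.
  by apply: le_extend_infty => //; [exact: rearr_ge0|exact: le_rearr].
Qed.

Lemma rho_le_ae h1 h2 : {ae mI (R := R), forall t, `|h1 t| <= `|h2 t|} ->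
  (rho h1 <= rho h2)%E.
Proof.
move=> h12; apply: le_rho => l l0; apply: mI_le_ae.
by apply: filterS h12 => t + /= lt1; exact: lt_le_trans.
Qed.

(** Substitute t = 2 s in the modular of h: then [rearr_add] bounds the
rearrangement, and w (2 s) <= w s. *)
Lemma rho_subadd h h1 h2 :
  (forall l, 0 < l -> (distr h l <= distr h1 l + distr h2 l)%E) ->
  (rho h <= 2%:E * (rho h1 + rho h2))%E.
Proof.
move=> hh; rewrite /rho.
have m0 t : t \in `]0%R, +oo[ -> 0 < t by rewrite in_itv /= andbT.
rewrite (ge0_integral_scale (@ltr0n R 2))//; last 2 first.
- exact: measurable_modular_integrand.
- by move=> t /m0; exact: modular_integrand_ge0.
rewrite (_ : _ @^-1` _ = `]0%R, +oo[%classic); last first.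
  apply/seteqP; split=> x /=; rewrite !in_itv /= !andbT.
    by rewrite pmulr_rgt0.
  by rewrite pmulr_rgt0.
rewrite lee_pmul2l// -ge0_integralD//; last 4 first.
- by move=> t /m0; exact: modular_integrand_ge0.
- exact: measurable_modular_integrand.
- by move=> t /m0; exact: modular_integrand_ge0.
- exact: measurable_modular_integrand.
apply: ge0_le_integral => //=.
- by move=> t /m0 t0; apply: modular_integrand_ge0; rewrite mulr_gt0.
- apply: nonincreasing_measurableE; first exact: interval_is_interval.
  move=> s t /m0 s0 _ st.
  apply: modular_integrand_nincr; first by rewrite mulr_gt0.
  by rewrite ler_pM2l.
- by apply: emeasurable_funD; exact: measurable_modular_integrand.
move=> t /m0 t0.
apply: (@le_trans _ _ (extend_infty phi (rearr h (2 * t)) * (w t)%:E)%E).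
  rewrite lee_wpmul2l ?extend_infty_ge0 ?rearr_ge0// lee_fin.
  by apply: (weight_nincr hw) => //; rewrite ler_peMl ?ler1n// ltW.
rewrite -ge0_muleDl ?extend_infty_ge0 ?rearr_ge0//.
rewrite lee_wpmul2r ?(weight_ge0 hw)//.
apply: le_trans (le_extend_infty ophi (rearr_ge0 _ _) (rearr_add t hh)) _.
have [_|_] := leP (rearr h1 t) (rearr h2 t).
  by rewrite leeDr// extend_infty_ge0// rearr_ge0.
by rewrite leeDl// extend_infty_ge0// rearr_ge0.
Qed.

(** The rearrangement is at least l on ]0, t0[. *)
Lemma rho_chebyshev h l t0 : 0 < l -> (t0%:E <= distr h l)%E ->
  ((phi l)%:E * weight_primitive w t0 <= rho h)%E.
Proof.
move=> l0 dl.
have sub : `]0%R, t0[ `<=` (`]0%R, +oo[%classic : set R).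
  by move=> x /=; rewrite !in_itv /= => /andP[->].
rewrite -ge0_integralZl//; last 3 first.
- by apply: measurable_weightS.
- by move=> x /sub /=; rewrite in_itv /= andbT; exact: weight_ge0.
- by rewrite lee_fin (orlicz_ge0 ophi)// ltW.
apply: (@le_trans _ _ (\int[mu]_(t in `]0%R, t0[)
    (extend_infty phi (rearr h t) * (w t)%:E))%E).
  apply: ge0_le_integral => //.
  - move=> x /sub /=; rewrite in_itv /= andbT => x0.
    by rewrite mule_ge0 ?(weight_ge0 hw)// lee_fin (orlicz_ge0 ophi)// ltW.
  - by apply: emeasurable_funM => //; apply: measurable_weightS.
  - by apply: measurable_funS sub _ => //; exact: measurable_modular_integrand.
  - move=> x /=; rewrite in_itv /= => /andP[x0 xt0].
    rewrite lee_wpmul2r ?(weight_ge0 hw)//.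
    have -> : ((phi l)%:E = extend_infty phi l%:E)%E by [].
    apply: le_extend_infty => //; first by rewrite lee_fin ltW.
    exact: rearr_ge xt0 dl.
apply: ge0_subset_integral => //.
- exact: measurable_modular_integrand.
- by move=> t /=; rewrite in_itv /= andbT; exact: modular_integrand_ge0.
Qed.

End orlicz.
End rearrangement.

(** * Classes of functions and order continuity *)
Section L0.
Context (R : realType).
Notation F := {mfun lebesgue_line R >-> R}.
Implicit Types (x y : L0 R).
Local Open Scope quotient_scope.

Lemma ae_repr_pi (f : F) :
  {ae mI (R := R), forall t, (\pi_(L0 R) f : L0 R) t = f t}.
Proof. exact: aeq_repr_pi. Qed.

Lemma L0_eqP x y : x = y <-> {ae mI (R := R), forall t, x t = y t}.
Proof. by rewrite -{1}[x]reprK -{1}[y]reprK; exact: aeq_piP. Qed.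

Lemma ae_scaleE (k : R) x :
  {ae mI (R := R), forall t, (k *: x : L0 R) t = k * x t}.
Proof. exact: (ae_repr_pi (k *: (repr x : F))). Qed.

Lemma ae_addE x y : {ae mI (R := R), forall t, (x + y : L0 R) t = x t + y t}.
Proof. exact: (ae_repr_pi ((repr x : F) + (repr y : F))). Qed.

Lemma ae_oppE x : {ae mI (R := R), forall t, (- x : L0 R) t = - x t}.
Proof. exact: (ae_repr_pi (- (repr x : F))). Qed.

Lemma ae_0E : {ae mI (R := R), forall t, (0 : L0 R) t = 0}.
Proof. exact: (ae_repr_pi (0 : F)). Qed.

Lemma measurable_superlevel x (l : R) : measurable [set t | l < `|x t|].
Proof.
have mx : measurable_fun setT (fun t => `|x t|) by exact: measurableT_comp.
have := mx measurableT _ (measurable_itv `]l, +oo[).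
rewrite setTI; congr measurable; apply/seteqP; split=> t /=.
  by rewrite in_itv /= andbT.
by rewrite in_itv /= andbT.
Qed.

Variables (phi w : R -> R).
Hypotheses (ophi : orlicz_function phi) (hw : weight_function w).

Lemma modular_scale (k : R) x :
  modular phi w (k *: x) = rho phi w (fun t => k * x t).
Proof.
rewrite modularE; apply/eqP; rewrite eq_le; apply/andP; split.
- by apply: (rho_le_ae ophi hw); apply: filterS (ae_scaleE k x) => t ->.
- by apply: (rho_le_ae ophi hw); apply: filterS (ae_scaleE k x) => t ->.
Qed.

(** If h exceeded l on a set of infinite measure, Chebyshev's inequality would
bound phi l times the integral of w over the whole half-line, which is
infinite. *)
Lemma distr_lty (h : lebesgue_line R -> R) l : (rho phi w h < +oo)%E -> 0 < l ->
  (distr h l < +oo)%E.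
Proof.
move=> hoo l0; rewrite ltey; apply/eqP => dl.
have hfin : rho phi w h \is a fin_num.
  by rewrite ge0_fin_numE ?(rho_ge0 ophi hw).
have pl := orlicz_gt0 ophi l0.
have [t t0 Wt] := weight_primitive_large hw (fine (rho phi w h) / phi l).
have := rho_chebyshev ophi hw (h := h) (t0 := t) l0.
rewrite dl leey => /(_ isT); apply/negP; rewrite -ltNge -(fineK hfin).
move: Wt; rewrite -(fineK (weight_primitive_fin hw t)) -EFinM !lte_fin.
by rewrite ltr_pdivrMr// mulrC.
Qed.

Lemma le_luxemburg_norm x y : {ae mI (R := R), forall t, `|x t| <= `|y t|} ->
  (luxemburg_norm phi w x <= luxemburg_norm phi w y)%E.
Proof.
move=> xy; rewrite /luxemburg_norm.
apply: ereal_inf_le_tmp => _ [e [e0 ye] <-]; exists e; last by [].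
split; first exact: e0.
apply: le_trans ye; rewrite !modular_scale; apply: (rho_le_ae ophi hw).
by apply: filterS xy => t xyt; rewrite !normrM ler_wpM2l.
Qed.

(** Continuity of the measure from above, applied to the sets where some later
term exceeds l: the first has finite measure thanks to the domination, and their
intersection is null. *)
Lemma distr_cvg0 (x : L0 R) (X : nat -> L0 R) (l : R) : 0 < l ->
  (distr x l < +oo)%E ->
  (forall n, {ae mI (R := R), forall t, `|X n t| <= `|x t|}) ->
  {ae mI (R := R), forall t, (fun n => `|X n t|) @ \oo --> (0 : R)} ->
  (fun n => distr (X n) l) @ \oo --> 0%E.
Proof.
move=> l0 dx Xx X0.
pose B n := \bigcup_(m in [set m | (n <= m)%N]) [set t | l < `|X m t|].
have mB n : measurable (B n).
  by apply: bigcup_measurable => m _; exact: measurable_superlevel.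
have B0 : (mI (B 0%N) < +oo)%E.
  apply: le_lt_trans dx; apply: mI_le_ae.
  have /ae_foralln := Xx; apply: filterS => t Xt [m _ /= lm].
  exact: lt_le_trans lm (Xt m).
have mIB : measurable (\bigcap_n B n) by exact: bigcapT_measurable.
have ndB : {homo B : n m / (n <= m)%N >-> (m <= n)%O}.
  move=> n m nm; apply/subsetPset => t [k /= mk lk]; exists k => //=.
  exact: leq_trans mk.
have nullB : @mI R (\bigcap_n B n) = 0%E.
  apply/eqP; rewrite eq_le measure_ge0 andbT -(@measure0 _ _ _ (@mI R)).
  apply: mI_le_ae; apply: filterS X0 => t Xt Bt.
  have /cvgr0Pnorm_lt/(_ _ l0)[n _ Hn] := Xt.
  have [m /= nm lm] := Bt n I.
  by have := Hn m nm; rewrite /= normr_id ltNge (ltW lm).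
have cvB : (fun n => @mI R (B n)) @ \oo --> 0%E.
  by rewrite -nullB; exact: (nonincreasing_cvg_mu B0 mB mIB ndB).
apply: (squeeze_cvge (f := fun=> 0%E) _ _ cvB); last exact: cvg_cst.
apply: nearW => n; rewrite measure_ge0/=; apply: mI_le => t lt.
by exists n => //=.
Qed.

(** Dominated convergence on the half-line: the rearrangements tend to 0 at every
t > 0 by [distr_cvg0], and phi tends to 0 at 0. *)
Lemma rho_cvg0 (x : L0 R) (X : nat -> L0 R) : (rho phi w x < +oo)%E ->
  (forall n, {ae mI (R := R), forall t, `|X n t| <= `|x t|}) ->
  {ae mI (R := R), forall t, (fun n => `|X n t|) @ \oo --> (0 : R)} ->
  (fun n => rho phi w (X n)) @ \oo --> 0%E.
Proof.
move=> xoo Xx X0.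
pose D : set R := `]0%R, +oo[%classic.
have D0 t : D t -> 0 < t by rewrite /D /= in_itv /= andbT.
have [] := @dominated_convergence _ _ _ (@lebesgue_measure R) D
  (measurable_itv _)
  (fun n t => extend_infty phi (rearr (X n) t) * (w t)%:E)%E (cst 0%E)
  (fun t => extend_infty phi (rearr x t) * (w t)%:E)%E.
- by move=> n; exact: measurable_modular_integrand.
- exact: measurable_cst.
- apply: aeW => t /D0 t0.
  rewrite -[X in _ --> X](mul0e (w t)%:E).
  apply: cvgeZr => //; apply: extend_infty_cvg0 => // [n|e e0].
    exact: rearr_ge0.
  have /fine_cvgP[dfin /cvgrPdist_lt] := distr_cvg0 e0 (distr_lty xoo e0) Xx X0.
  move=> /(_ _ t0); apply: filterS2 dfin => n dfin.
  rewrite sub0r normrN => dn; apply: rearr_le => //.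
  by rewrite -(fineK dfin) lee_fin ltW// (le_lt_trans (ler_norm _) dn).
- apply/integrableP; split; first exact: measurable_modular_integrand.
  apply: le_lt_trans xoo; rewrite le_eqVlt; apply/orP; left; apply/eqP.
  apply: eq_integral => t; rewrite inE => /D0 t0.
  by rewrite gee0_abs// modular_integrand_ge0.
- apply: aeW => t n /D0 t0; rewrite gee0_abs ?modular_integrand_ge0//.
  rewrite lee_wpmul2r ?(weight_ge0 hw)//; apply: le_extend_infty => //.
    exact: rearr_ge0.
  apply: le_rearr => l _; apply: mI_le_ae; apply: filterS (Xx n) => s + /= ls.
  exact: lt_le_trans.
- by move=> _ _; rewrite integral0.
Qed.

Lemma order_continuous_of_modular (x : L0 R) :
  (forall K, 0 < K -> (modular phi w (K *: x) < +oo)%E) ->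
  orlicz_lorentz_oc phi w x.
Proof.
move=> xK; split; first by exists 1 => //; exact: xK.
move=> X Xx Xcvg; split.
  move=> m n mn; apply: le_luxemburg_norm; apply: filterS Xcvg => t [Xni _].
  exact: Xni.
have lux0 n : (0 <= luxemburg_norm phi w (X n))%E.
  by apply: le_ereal_inf_tmp => _ [e [e0 _] <-]; rewrite lee_fin ltW.
apply: ge0_cvge0 => // e e0.
have ei0 : 0 < e^-1 by rewrite invr_gt0.
have : (fun n => rho phi w (e^-1 *: X n : L0 R)) @ \oo --> 0%E.
  apply: (@rho_cvg0 (e^-1 *: x)); first exact: xK.
  - move=> n; apply: filterS3 (Xx n) (ae_scaleE e^-1 x) (ae_scaleE e^-1 (X n)).
    by move=> t Xxt -> ->; rewrite !normrM ler_wpM2l.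
  - have /ae_foralln := fun n => ae_scaleE e^-1 (X n).
    apply: filterS2 Xcvg => t [_ Xt] Et.
    under eq_fun do rewrite Et normrM.
    by rewrite -(mulr0 `|e^-1|); apply: cvgMl_tmp.
move=> /fine_cvgP[rfin /cvgrPdist_lt /(_ _ ltr01)].
apply: filterS2 rfin => n rfin.
rewrite sub0r normrN => r1; apply: ereal_inf_lbound; exists e => //; split=> //.
by rewrite modularE -(fineK rfin) lee_fin ltW// (le_lt_trans (ler_norm _) r1).
Qed.

(** The hypothesis is what is left, almost everywhere, of h = h1 + h2. *)
Lemma rho_add (h h1 h2 : lebesgue_line R -> R) :
  {ae mI (R := R), forall t, `|h t| <= `|h1 t| + `|h2 t|} ->
  (rho phi w h <= 2%:E * (rho phi w (fun t => 2 * h1 t)%R +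
                          rho phi w (fun t => 2 * h2 t)%R))%E.
Proof.
move=> hh; apply: (rho_subadd ophi hw) => l l0; apply: le_trans (mI_U _ _).
apply: mI_le_ae; apply: filterS hh => t ht /= /lt_le_trans /(_ ht) lt.
rewrite !normrM (ger0_norm (ler0n R 2)).
have [h12|h12] := leP `|h1 t| `|h2 t|; [right|left]; lra.
Qed.

(** The modular is nondecreasing in the modulus of the factor. *)
Lemma luxemburg_lt_modular x (e K : R) : (luxemburg_norm phi w x < e%:E)%E ->
  `|K| <= e^-1 -> (rho phi w (fun t => K * x t)%R <= 1)%E.
Proof.
move=> /ereal_inf_lt[_ [e' [e'0 xe'] <-]]; rewrite lte_fin => e'e Ke.
apply: le_trans xe'; rewrite modular_scale; apply: (rho_le_ae ophi hw).
apply: nearW => t; rewrite !normrM ler_wpM2r//.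
have ei0 : 0 < e'^-1 by rewrite invr_gt0.
rewrite (gtr0_norm ei0); apply: le_trans Ke _.
by rewrite lef_pV2 ?posrE ?(lt_trans e'0 e'e)// ltW.
Qed.

(** Convergence in norm implies convergence in measure: were x larger than l on a
set of measure d, then (v / l) x would exceed v there, and Chebyshev's inequality
would give a modular above phi v W(d) > 1. *)
Lemma luxemburg_distr (l d : R) : 0 < l -> 0 < d -> exists2 e : R, 0 < e &
  forall x, (luxemburg_norm phi w x < e%:E)%E -> (distr x l <= d%:E)%E.
Proof.
move=> l0 d0.
have Wd0 : 0 < fine (weight_primitive w d).
  by rewrite -lte_fin fineK ?(weight_primitive_fin hw)// weight_primitive_gt0.
have [v v0 Wv] := orlicz_unbounded ophi (fine (weight_primitive w d))^-1.
have ev0 : 0 < l / v by rewrite divr_gt0.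
exists (l / v) => // x Nx.
have rho1 : (rho phi w (fun t => (v / l) * x t)%R <= 1)%E.
  apply: luxemburg_lt_modular Nx _; rewrite invf_div ger0_norm//.
  by rewrite divr_ge0// ltW.
rewrite leNgt; apply/negP => /ltW dx.
have dvx : (d%:E <= distr (fun t => (v / l) * x t)%R v)%E.
  apply: le_trans dx _; apply: mI_le => t /= lt.
  rewrite normrM ger0_norm ?divr_ge0// ?ltW//.
  by rewrite mulrAC ltr_pdivlMr// ltr_pM2l.
have := rho_chebyshev ophi hw v0 dvx.
move=> /le_trans /(_ rho1); rewrite -(fineK (weight_primitive_fin hw d)).
rewrite -EFinM lee_fin leNgt => /negP; apply.
by rewrite -ltr_pdivrMr// mul1r.
Qed.

End L0.

(** * Hamel bases *)
Section hamel.
Context (R : realType) (V : lmodType R).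
Implicit Types (M B : set V).

Lemma lin_span_sub M B : submod_closed (mem M) -> B `<=` M -> lin_span B `<=` M.
Proof.
move=> [M0 Mlin] BM u [s [c [sB ->]]].
suff : \sum_(v <- s) c v *: v \in mem M by rewrite inE.
elim: s sB => [|v s IH] sB; first by rewrite big_nil.
rewrite big_cons; apply: Mlin.
  by rewrite inE; apply/BM/sB; rewrite inE eqxx.
by apply: IH => z zs; apply: sB; rewrite inE zs orbT.
Qed.

Lemma sub_lin_span B : B `<=` lin_span B.
Proof.
move=> v Bv; exists [:: v], (fun=> 1); split; last by rewrite big_seq1 scale1r.
by move=> z; rewrite inE => /eqP->.
Qed.

Lemma lin_independentU1 B u : lin_independent B -> ~ lin_span B u ->
  lin_independent (u |` B).
Proof.
move=> iB uB s c us sB s0.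
have remB v : v \in rem u s -> B v.
  rewrite mem_rem_uniq// inE => /andP[/= vu /sB[vE|//]].
  by rewrite vE eqxx in vu.
have cs : (u \in s -> c u = 0) -> forall v, v \in s -> c v = 0.
  move=> cu v vs; have [vE|vu] := eqVneq v u; first by rewrite vE cu// -vE.
  apply: (iB (rem u s) c) => //.
  - exact: rem_uniq.
  - have [us'|uNs] := boolP (u \in s); last by rewrite rem_id.
    by move: s0; rewrite (big_rem u us')/= (cu us') scale0r add0r.
  - by rewrite mem_rem_uniq// inE vu.
apply: cs => us'; apply: contra_notP uB => /eqP cu0.
exists (rem u s), (fun v => - (c u)^-1 * c v); split => //.
move: s0; rewrite (big_rem u us')/= => /eqP; rewrite addr_eq0 => /eqP cuE.
under eq_bigr do rewrite -scalerA.
by rewrite -scaler_sumr scaleNr -scalerN -cuE scalerA mulVf// scale1r.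
Qed.

(** Zorn's lemma is applied to the sets B such that B0 `|` B is independent, rather
than to the independent sets containing B0: the union of the empty chain is then
admissible. *)
Lemma hamel_basis_extend M B0 : submod_closed (mem M) -> B0 `<=` M ->
  lin_independent B0 -> exists2 B, hamel_basis M B & B0 `<=` B.
Proof.
move=> sM B0M iB0.
pose P := [set B | B `<=` M /\ lin_independent (B0 `|` B)].
have [] := @Zorn_bigcup V P.
  move=> F FP totF; split; first by move=> v [X /FP[XM _]]; exact: XM.
  move=> s c us sF.
  have [X [iX sX]] : exists X, lin_independent (B0 `|` X) /\
      forall v, v \in s -> (B0 `|` X) v.
    have : exists2 X, (X = set0 \/ F X) & forall v, v \in s -> (B0 `|` X) v.
      elim: s us sF => [|v s IH] us sF; first by exists set0; [left|].
      have [||X FX sX] := IH.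
      - by case/andP: us.
      - by move=> z zs; apply: sF; rewrite inE zs orbT.
      have [|Bv|[Y FY Yv]] := sF v; first by rewrite inE eqxx.
        by exists X => // z; rewrite inE => /orP[/eqP->|/sX//]; left.
      have XY : exists2 Z, F Z & X `<=` Z /\ Y `<=` Z.
        case: FX => [->|FX].
          by exists Y => //; split=> //; exact: sub0set.
        have [XY|YX] := totF _ _ FX FY; first by exists Y => //; split.
        by exists X => //; split.
      have [Z FZ [XZ YZ]] := XY; exists Z; first by right.
      move=> z; rewrite inE => /orP[/eqP->|/sX[|/XZ]]; [right|left|right] => //.
      exact: YZ.
    move=> [X [X0|/FP[_ iX]] sX]; exists X; split=> //.
    by rewrite X0 setU0.
  exact: iX.
move=> B [[BM iB] maxB]; exists (B0 `|` B); last by move=> v; left.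
split=> //; apply/seteqP; split.
  by apply: lin_span_sub => // v [/B0M|/BM].
move=> u Mu; apply: contrapT => uB.
have uNB : ~ B u by move=> Bu; apply: uB; apply: sub_lin_span; right.
apply: (maxB (u |` B)).
  split; first by move=> v; right.
  by move=> /(_ u (or_introl erefl)).
split; first by move=> v [->|/BM].
rewrite setUCA; exact: lin_independentU1.
Qed.

End hamel.

(** * The cardinality of the space of measurable functions *)
Section continuum.
Context (R : realType).
Implicit Types b c : nat -> bool.

Definition ternary_sum b m : R := \sum_(i < m) (b i)%:R * 3%:R ^- i.

(** The expansion of b in base 3 with digits 0 and 1; leaving the digit 2 out makes
it unique. *)
Definition ternary b : R := sup (range (ternary_sum b)).

Lemma ternary_sumS b m :
  ternary_sum b m.+1 = ternary_sum b m + (b m)%:R * 3%:R ^- m.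
Proof. by rewrite /ternary_sum big_ord_recr. Qed.

Lemma ternary_sum_tail b n k :
  ternary_sum b (n + k) <=
  ternary_sum b n + 3%:R ^- n * (3%:R - 3%:R ^- k * 3%:R) / 2%:R.
Proof.
elim: k => [|k IH].
  by rewrite addn0 expr0 invr1 mul1r subrr mulr0 mul0r addr0.
rewrite addnS ternary_sumS.
apply: le_trans (lerD IH (_ : _ <= 3%:R ^- (n + k))) _.
  by rewrite ler_piMl// ?invr_ge0 ?exprn_ge0//; case: (b _).
rewrite -addrA lerD2l exprD exprS !invfM.
have n0 : 0 < 3%:R ^- n :> R by rewrite invr_gt0 exprn_gt0.
have k0 : 0 < 3%:R ^- k :> R by rewrite invr_gt0 exprn_gt0.
move: (3%:R ^- n) (3%:R ^- k) n0 k0 => x y x0 y0.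
by rewrite le_eqVlt; apply/orP; left; apply/eqP; field.
Qed.

Lemma ternary_sum_nd b m n : (m <= n)%N -> ternary_sum b m <= ternary_sum b n.
Proof.
move=> /subnK <-; elim: (n - m)%N => // k IH; apply: le_trans IH _.
by rewrite addSn ternary_sumS lerDl mulr_ge0// invr_ge0 exprn_ge0.
Qed.

Lemma ternary_sum_ub b n m :
  ternary_sum b m <= ternary_sum b n + 3%:R ^- n * 3%:R / 2%:R.
Proof.
have n0 : 0 < 3%:R ^- n :> R by rewrite invr_gt0 exprn_gt0.
have [mn|/ltnW /subnKC <-] := leqP m n.
  by apply: le_trans (ternary_sum_nd b mn) _; rewrite lerDl !mulr_ge0// ltW.
apply: le_trans (ternary_sum_tail _ _ _) _.
rewrite lerD2l ler_pM2r ?invr_gt0// ler_pM2l// gerBl mulr_ge0//.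
Qed.

Lemma ternary_ge b n : ternary_sum b n <= ternary b.
Proof.
apply: ub_le_sup; last by exists n.
exists (ternary_sum b 0 + 3%:R ^- 0 * 3%:R / 2%:R) => _ [m _ <-].
exact: ternary_sum_ub.
Qed.

Lemma ternary_le b n : ternary b <= ternary_sum b n + 3%:R ^- n * 3%:R / 2%:R.
Proof.
apply: ge_sup; first by exists (ternary_sum b 0); exists 0%N.
by move=> _ [m _ <-]; exact: ternary_sum_ub.
Qed.

(** The digit of b at the first difference is worth 3 ^ - n, all the later digits of
c together at most half of that. *)
Lemma ternary_lt b c n : (forall i, (i < n)%N -> b i = c i) ->
  b n -> ~~ c n -> ternary c < ternary b.
Proof.
move=> bc bn cn; apply: le_lt_trans (ternary_le c n.+1) _.
apply: lt_le_trans (ternary_ge b n.+1); rewrite !ternary_sumS bn (negbTE cn).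
have -> : ternary_sum b n = ternary_sum c n.
  by apply: eq_bigr => i _; rewrite bc.
rewrite mul0r addr0 mul1r ltrD2l exprS invfM.
have n0 : 0 < 3%:R ^- n :> R by rewrite invr_gt0 exprn_gt0.
by lra.
Qed.

Lemma ternary_inj : injective ternary.
Proof.
move=> b c bc; apply/funext => n; apply/eqP; apply: contrapT => /negP nbc.
have ex : exists n, b n != c n by exists n.
case: (ex_minnP ex) => {nbc}m bcm minm.
have agree i : (i < m)%N -> b i = c i.
  by move=> im; apply/eqP; apply: contraTT im => /minm; rewrite -leqNgt.
case bm : (b m); move: bcm; rewrite bm => cm.
  have /(ternary_lt agree bm) : ~~ c m by move: cm; case: (c m).
  by rewrite bc ltxx.
have cmT : c m by move: cm; case: (c m).
have := @ternary_lt c b m (fun i im => esym (agree i im)) cmT.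
by rewrite bm bc ltxx => /(_ isT).
Qed.

End continuum.

Section cardinality_L0.
Context (R : realType).
Notation m := (@completed_lebesgue_measure R).
Implicit Types (A B : set (lebesgue_line R)) (x y : L0 R) (U V : set R).

Lemma open_rat_eq U V : open U -> open V ->
  (forall p q : rat, `]ratr p, ratr q[ `<=` U <-> `]ratr p, ratr q[ `<=` V) ->
  U = V.
Proof.
wlog suff H : U V / open U ->
    (forall p q : rat, `]ratr p, ratr q[ `<=` U -> `]ratr p, ratr q[ `<=` V) ->
    U `<=` V.
  move=> oU oV UV; apply/seteqP; split.
    by apply: H => // p q; case: (UV p q).
  by apply: H => // p q; case: (UV p q).
move=> oU UV t Ut.
have /nbhs_ballP[e /= e0 eU] := open_nbhs_nbhs (conj oU Ut : open_nbhs t U).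
have te : t - e < t by rewrite gtrBl.
have [p] := rat_in_itvoo te.
rewrite in_itv /= => /andP[ep pt].
have te' : t < t + e by rewrite ltrDl.
have [q] := rat_in_itvoo te'.
rewrite in_itv /= => /andP[tq qe].
apply: (UV p q); last by rewrite /= in_itv /= pt tq.
move=> s /=; rewrite in_itv /= => /andP[ps sq]; apply: eU => /=.
rewrite -ball_normE /= ltr_distlC; apply/andP.
by split; [exact: lt_trans ps|exact: lt_trans qe].
Qed.

Lemma outer_regular A n : (m A < +oo)%E ->
  exists U, [/\ open U, A `<=` U & (m U <= m A + n.+1%:R^-1%:E)%E].
Proof.
move=> Aoo; have Afin : m A \is a fin_num by rewrite ge0_fin_numE ?measure_ge0.
have n0 : 0 < n.+1%:R^-1 :> R by rewrite invr_gt0.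
have mAE : m A = ereal_inf [set m U | U in [set U | open U /\ A `<=` U]].
  exact: outer_measure_open.
have infin := Afin; rewrite mAE in infin.
have [_ [U [oU AU] <-]] := lb_ereal_inf_adherent n0 infin.
by rewrite -mAE => /ltW mU; exists U.
Qed.

(** By outer regularity these open sets, for all n, determine A up to a null set; an
open set is in turn determined by the rational intervals that it contains.  A
measurable function is determined almost everywhere by its superlevel sets, hence
by countably many yes-or-no answers. *)
Definition regular_cover A n : set R :=
  xget setT [set U | [/\ open U, A `<=` U & (m U <= m A + n.+1%:R^-1%:E)%E]].

Lemma regular_coverP A n : (m A < +oo)%E ->
  [/\ open (regular_cover A n), A `<=` regular_cover A n &
      (m (regular_cover A n) <= m A + n.+1%:R^-1%:E)%E].
Proof.
move=> /(outer_regular n)[U HU]; rewrite /regular_cover.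
by case: xgetP => [V _ //|/(_ U)].
Qed.

Lemma regular_cover_null A B : measurable A -> measurable B ->
  (m A < +oo)%E -> (m B < +oo)%E ->
  (forall n, regular_cover A n = regular_cover B n) -> m (B `\` A) = 0%E.
Proof.
move=> mA mB Aoo Boo AB; apply/eqP; rewrite eq_le measure_ge0 andbT.
apply/lee_addgt0Pr => e e0; rewrite add0e.
have [n _ /(_ n (leqnn n)) /= ne] := near_infty_natSinv_lt (PosNum e0).
have [oU AU mU] := regular_coverP n Aoo.
have [_ BU _] := regular_coverP n Boo.
pose U : set (lebesgue_line R) := regular_cover A n.
have mUm : measurable U by apply: sub_caratheodory; exact: open_measurable.
apply: (@le_trans _ _ (m (U `\` A))).
  apply: le_outer_measure => t [Bt nAt]; split=> //.
  by rewrite /U AB; exact: BU.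
have Uoo : (m U < +oo)%E.
  by apply: le_lt_trans mU _; rewrite lte_add_pinfty ?ltry.
rewrite measureD// (_ : U `&` A = A); last first.
  by apply/seteqP; split=> [t []//|t At]; split=> //; exact: AU.
rewrite leeBlDr ?ge0_fin_numE ?measure_ge0//; apply: le_trans mU _.
by rewrite addeC leeD2r// lee_fin ltW.
Qed.

(** The truncation makes the measure finite. *)
Definition truncated_superlevel x (q : rat) (N : nat) : set (lebesgue_line R) :=
  [set t | ratr q < x t] `&` `[0, N%:R : R].

Lemma measurable_truncated_superlevel x q N :
  measurable (truncated_superlevel x q N).
Proof.
apply: measurableI; last by apply: sub_caratheodory; exact: measurable_itv.
have mx : measurable_fun setT x by [].
have := mx measurableT _ (measurable_itv `]ratr q, +oo[).
rewrite setTI; congr measurable; apply/seteqP; split=> t /=.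
  by rewrite in_itv /= andbT.
by rewrite in_itv /= andbT.
Qed.

Lemma truncated_superlevel_lty x q N :
  (m (truncated_superlevel x q N) < +oo)%E.
Proof.
apply: (@le_lt_trans _ _ (m (`[0, N%:R : R]%classic : set R))).
  by apply: le_outer_measure => t [].
have -> : m (`[0, N%:R : R]%classic : set R) =
    lebesgue_measure (`[0, N%:R : R]%classic : set R) by [].
by rewrite lebesgue_measure_itv /=; case: ifP => _; rewrite ltry.
Qed.

Definition L0_code x (k : nat) : bool :=
  if unpickle k is Some (q, N, n, p1, p2) then
    `[< `]ratr p1, ratr p2[ `<=` regular_cover (truncated_superlevel x q N) n >]
  else false.

Lemma L0_code_null x y : L0_code x = L0_code y ->
  {ae mI (R := R), forall t, forall q : rat, ratr q < y t -> ratr q < x t}.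
Proof.
move=> xy.
have cov q N n : regular_cover (truncated_superlevel x q N) n =
    regular_cover (truncated_superlevel y q N) n.
  have [oU _ _] := regular_coverP n (truncated_superlevel_lty x q N).
  have [oV _ _] := regular_coverP n (truncated_superlevel_lty y q N).
  apply: open_rat_eq => // p1 p2.
  have := congr1 (fun f => f (pickle (q, N, n, p1, p2))) xy.
  by rewrite /L0_code pickleK; exact: asbool_eq_equiv.
have nul k : {ae mI (R := R), forall t, if unpickle k is Some (q, N) then
    t \in `[0, N%:R : R] -> ratr q < y t -> ratr q < x t else True}.
  case: (unpickle k) => [[q N]|]; last exact: nearW.
  have mx := measurable_truncated_superlevel x q N.
  have my := measurable_truncated_superlevel y q N.
  exists (truncated_superlevel y q N `\` truncated_superlevel x q N); split.
  - exact: measurableD.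
  - apply/eqP; rewrite eq_le measure_ge0 andbT.
    rewrite -(regular_cover_null mx my (truncated_superlevel_lty _ _ _)
      (truncated_superlevel_lty _ _ _) (cov q N)).
    by apply: le_outer_measure => t [].
  - move=> t /= /not_implyP[tN] /not_implyP[qy nqx]; split; first by split.
    by case.
have H : {ae mI (R := R), forall t, halfline t}.
  exists (~` @halfline R); split=> //.
    exact/measurableC/measurable_halfline.
  by rewrite /mI /mrestr setICl measure0.
have /ae_foralln := nul; apply: filterS2 H => t t0 tk q qy.
have := tk (pickle (q, Num.bound t)); rewrite pickleK; apply => //.
by rewrite in_itv /=; apply/andP; split => //; apply: ltW; exact: archi_boundP.
Qed.

Lemma L0_code_inj : injective L0_code.
Proof.
move=> x y xy; apply/L0_eqP.
apply: filterS2 (L0_code_null xy) (L0_code_null (esym xy)) => t yx xy' .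
apply/eqP; rewrite eq_le !leNgt; apply/andP; split; apply/negP.
  move=> /rat_in_itvoo[q]; rewrite in_itv /= => /andP[yq /xy' qy].
  by move: (lt_trans yq qy); rewrite ltxx.
move=> /rat_in_itvoo[q]; rewrite in_itv /= => /andP[xq /yx qx].
by move: (lt_trans xq qx); rewrite ltxx.
Qed.

Lemma card_L0 : ([set: L0 R] #<= [set: R])%card.
Proof.
apply/pcard_injP; exists (@ternary R \o L0_code).
by move=> x y _ _ /(@ternary_inj R) /L0_code_inj.
Qed.

End cardinality_L0.

(** * Power sums, intersecting intervals and step functions *)
Section vandermonde.
Context (R : fieldType) (I : eqType).

(** Vandermonde: the hypothesis extends by linearity from powers to polynomials, and
the polynomial vanishing at all r u with u != v isolates c v. *)
Lemma power_sums_eq0 (s : seq I) (r c : I -> R) :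
  uniq s -> {in s &, injective r} ->
  (forall k, \sum_(v <- s) c v * r v ^+ k = 0) -> forall v, v \in s -> c v = 0.
Proof.
move=> us ri c0 v vs.
have cp (p : {poly R}) : \sum_(v <- s) c v * p.[r v] = 0.
  under eq_bigr do rewrite horner_coef mulr_sumr.
  rewrite exchange_big /= big1// => i _.
  under eq_bigr do rewrite mulrCA.
  by rewrite -mulr_sumr c0 mulr0.
have := cp (\prod_(u <- rem v s) ('X - (r u)%:P)).
rewrite (big_rem v vs)/= [X in _ + X]big1_seq; last first.
  move=> u /andP[_ us']; rewrite horner_prod (big_rem u us')/=.
  by rewrite hornerXsubC subrr mul0r mulr0.
rewrite addr0 => /eqP; rewrite mulf_eq0 => /orP[/eqP//|].
rewrite horner_prod prodf_seq_eq0 => /hasP[u].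
rewrite mem_rem_uniq// inE => /andP[/= uv us']; rewrite hornerXsubC subr_eq0.
by move=> /eqP /(ri _ _ vs us') vu; rewrite vu eqxx in uv.
Qed.

End vandermonde.

(** Helly's theorem on the line: the supremum of the left end points lies in all
the intervals [x p - e p, x p + e p]. *)
Lemma interval_helly (R : realType) (x e : nat -> R) (P : nat) :
  (forall p q, (P <= p)%N -> (P <= q)%N -> x p - e p <= x q + e q) ->
  exists a, forall p, (P <= p)%N -> `|x p - a| <= e p.
Proof.
move=> xe; pose S := [set x p - e p | p in [set p | (P <= p)%N]].
have ubS q : (P <= q)%N -> ubound S (x q + e q).
  by move=> Pq _ [p Pp <-]; exact: xe.
have hS : has_sup S.
  split; first by exists (x P - e P); exists P => //=.
  by exists (x P + e P); exact: ubS.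
exists (sup S) => p Pp; rewrite ler_distlC; apply/andP; split.
  by apply: (sup_upper_bound hS); exists p.
by apply: ge_sup; [case: hS|exact: ubS].
Qed.

Section step.
Context d (T : measurableType d) (R : realType) (E : nat -> set T).
Hypotheses (mE : forall j, measurable (E j)) (tE : trivIset setT E).

(** Step functions are read off from the index of the piece, so that they depend
linearly on their values by computation. *)
Definition step_index (t : T) : option nat :=
  xget None [set o | exists2 j, o = Some j & E j t].

Lemma step_indexP t j : step_index t = Some j <-> E j t.
Proof.
rewrite /step_index; split.
  by case: xgetP => [_ -> [i ->] Ei [<-]|].
move=> Ej; case: xgetP => [_ -> [i -> Ei]|/(_ (Some j))]; last first.
  by move=> /(_ (ex_intro2 _ _ j erefl Ej)).
by congr Some; apply: (tE I I); exists t.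
Qed.

Lemma measurable_step_index (o : option nat) :
  measurable [set t | step_index t = o].
Proof.
case: o => [j|].
  by rewrite (_ : [set _ | _] = E j)//; apply/seteqP; split=> t /step_indexP.
rewrite (_ : [set _ | _] = ~` \bigcup_j E j).
  by apply: measurableC; exact: bigcupT_measurable.
apply/seteqP; split=> t /=; first by move=> t0 [j _ /step_indexP]; rewrite t0.
by case tj : (step_index t) => [j|]// []; exists j => //; exact/step_indexP.
Qed.

Definition step (c : nat -> R) (t : T) : R := oapp c 0 (step_index t).

Lemma measurable_step c : measurable_fun setT (step c).
Proof.
move=> _ Y mY; rewrite setTI.
have -> : step c @^-1` Y = \bigcup_(j in [set j | Y (c j)]) E j `|`
    (if `[< Y 0 >] then ~` \bigcup_j E j else set0).
  apply/seteqP; split=> t.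
    rewrite /= /step; case tj : (step_index t) => [j|] /= Yt.
      by left; exists j => //; apply/step_indexP.
    right; rewrite asboolT// => -[j _ /step_indexP]; by rewrite tj.
  move=> [[j /= Yj /step_indexP tj]|]; first by rewrite /step tj.
  case: ifPn => // /asboolP Y0 nt; rewrite /= /step.
  case tj : (step_index t) => [j|]//; exfalso; apply: nt; exists j => //.
  exact/step_indexP.
apply: measurableU; first exact: bigcup_measurable.
case: ifPn => // _; apply: measurableC; exact: bigcupT_measurable.
Qed.

Lemma stepE c j t : E j t -> step c t = c j.
Proof. by move=> /step_indexP tj; rewrite /step tj. Qed.

End step.

(** * The modular of a function bounded layer by layer *)
Section layers.
Context (R : realType) (phi w : R -> R).
Hypotheses (ophi : orlicz_function phi) (hw : weight_function w).
Variables (h : lebesgue_line R -> R) (E : nat -> set (lebesgue_line R)).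
Variables (c m : nat -> R).
Hypothesis c0 : forall j, 0 <= c j.
Hypothesis Em : forall j, (mI (E j) <= (m j)%:E)%E.
Hypothesis hc : forall t l, 0 < l -> l < `|h t| -> exists2 j, E j t & l < c j.

(** Otherwise the layers higher than l have lengths at most t / 2 ^ (j + 1), so that
h exceeds l on a set of measure at most t. *)
Lemma rearr_layers t l : 0 < t -> 0 < l -> (l%:E < rearr h t)%E ->
  exists2 j, l < c j & t < 2 ^+ j.+1 * m j.
Proof.
move=> t0 l0 lt; apply: contrapT => nex; move: lt; apply/negP; rewrite -leNgt.
apply: rearr_le => //.
pose F j := if l < c j then E j else set0.
apply: (@le_trans _ _ (mI (\bigcup_j F j))).
  apply: mI_le => s /= /(hc l0)[j Ejs lcj]; exists j => //.
  by rewrite /F lcj.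
apply: le_trans (mI_bigcup _) _.
apply: (@le_trans _ _ (\sum_(j <oo) (t / (2 ^ j.+1)%:R)%:E)%E).
  apply: lee_nneseries => // j _; rewrite /F; case: ifPn => lcj; last first.
    by rewrite measure0 lee_fin divr_ge0// ltW.
  apply: le_trans (Em j) _; rewrite lee_fin ler_pdivlMr ?ltr0n ?expn_gt0//.
  rewrite leNgt; apply/negP => tj; apply: nex; exists j => //.
  by rewrite -natrX mulrC.
by rewrite epsilon_trick0// ltW.
Qed.

(** Where the rearrangement at t is r, [rearr_layers] with l = r / 2 finds a layer
with phi r <= phi (2 c j) and t < 2 ^ (j + 1) m j; so the integrand at t is bounded
by one term of the sum.  Halving r is what introduces the factor 2 in the sum: it
replaces the attainment of a supremum, or the left continuity of phi. *)
Lemma rho_layers :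
  (rho phi w h <=
    \sum_(j <oo) (phi (2 * c j))%:E * weight_primitive w (2 ^+ j.+1 * m j)%R)%E.
Proof.
pose D : set R := `]0%R, +oo[%classic.
have D0 t : D t -> 0 < t by rewrite /D /= in_itv /= andbT.
pose I j : set R := `]0%R, (2 ^+ j.+1 * m j)%R[%classic.
have ID j : I j `<=` D by move=> t; rewrite /I /D /= !in_itv /= => /andP[->].
have p0 j : 0 <= phi (2 * c j) by rewrite (orlicz_ge0 ophi)// mulr_ge0.
pose f j := (fun t => (phi (2 * c j))%:E * (w t)%:E)%E \_ (I j).
have f0 j t : (0 <= f j t)%E.
  apply: erestrict_ge0 => s /ID/D0 s0.
  by rewrite mule_ge0 ?lee_fin// ltW// (weight_gt0 hw).
have mf j : measurable_fun D (f j).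
  apply/measurable_restrict; [exact: measurable_itv|exact: measurable_itv|].
  apply: emeasurable_funM => //; apply: (measurable_weightS hw) => t [].
  by move=> Dt _; exact: Dt.
have intf j : (\int[lebesgue_measure]_(t in D) f j t =
    (phi (2 * c j))%:E * weight_primitive w (2 ^+ j.+1 * m j)%R)%E.
  rewrite /f -integral_mkcondr setIidr//.
  rewrite ge0_integralZl//.
  - exact: measurable_itv.
  - by apply: (measurable_weightS hw) => t /ID.
  - by move=> t /ID/D0 t0; rewrite (weight_ge0 hw).
  - by rewrite lee_fin.
under eq_eseriesr do rewrite -intf.
rewrite -integral_nneseries//; last exact: measurable_itv.
apply: ge0_le_integral => //.
- by move=> t /D0; exact: modular_integrand_ge0.
- exact: measurable_modular_integrand.
- exact: (@ge0_emeasurable_sum _ _ R D f xpredT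
    (fun j t _ _ => f0 j t) (fun j _ => mf j)).
move=> t /D0 t0.
have S0 : (0 <= \sum_(j <oo) f j t)%E by exact: nneseries_ge0.
have term l : 0 < l -> (l%:E < rearr h t)%E ->
    ((phi (2 * l))%:E * (w t)%:E <= \sum_(j <oo) f j t)%E.
  move=> l0 /(rearr_layers t0 l0)[j lcj tj].
  have : (f j t <= \sum_(j <oo) f j t)%E.
    by rewrite (nneseriesD1 (n := j))// leeDl// nneseries_ge0.
  apply: le_trans; rewrite /f patchE mem_set; last first.
    by rewrite /I /= in_itv /= t0.
  rewrite lee_wpmul2r ?(weight_ge0 hw)// lee_fin (orlicz_le ophi)//.
    by rewrite mulr_ge0// ltW.
  by rewrite ler_pM2l// ltW.
case xt : (rearr h t) => [r| |].
- have r0 : 0 <= r by have := rearr_ge0 h t; rewrite xt.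
  have [->|rneq0] := eqVneq r 0; first by rewrite /= (orlicz0 ophi) mul0e.
  have rgt0 : 0 < r by rewrite lt_neqAle eq_sym rneq0.
  have := term (r / 2); rewrite divr_gt0// xt lte_fin ltr_pdivrMr//.
  rewrite mulr_natr mulr2n ltrDl rgt0 => /(_ isT isT).
  by rewrite mulrC divfK.
- rewrite /= gt0_mulye ?lte_fin ?(weight_gt0 hw)//.
  rewrite leye_eq; apply/eqP/eqyP => A A0.
  have [l l0 Al] := orlicz_unbounded ophi (A / w t).
  have := term l l0; rewrite xt ltry => /(_ isT); apply: le_trans.
  rewrite -EFinM lee_fin -ler_pdivrMr ?(weight_gt0 hw)//.
  apply: le_trans (ltW Al) _.
  by apply: (orlicz_le ophi); [exact: ltW|rewrite ler_peMl ?ler1n// ltW].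
- by have := rearr_ge0 h t; rewrite xt.
Qed.

End layers.

(** * Heights and lengths of the layers *)
Section selection.
Context (R : realType) (w phi : R -> R) (phi_ : nat -> R -> R).
Hypotheses (hw : weight_function w) (ophi : orlicz_function phi).
Hypothesis ophi_ : forall n, orlicz_function (phi_ n).
Hypothesis hDelta : forall n,
  Delta_rel_zero phi (phi_ n) \/ Delta_rel_infty phi (phi_ n).
Notation W := (weight_primitive w).

(** Apply the condition with the constant b / C, at its threshold u0: whether it
concerns small or large arguments, it covers u0. *)
Lemma domination_point n (b C : R) : 0 < b -> 0 < C ->
  exists2 u : R, 0 < u & phi (C * u) <= phi_ n (b * u).
Proof.
move=> b0 C0; have bC0 : 0 < b / C by rewrite divr_gt0.
have [u0 u00 H] : exists2 u0 : R, 0 < u0 & phi u0 <= phi_ n (b / C * u0).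
  by have [/(_ _ bC0)[u0 u00 H]|/(_ _ bC0)[u0 u00 H]] := hDelta n;
    exists u0 => //; apply: H => //; rewrite lexx ltW.
exists (u0 / C); first by rewrite divr_gt0.
by rewrite mulrCA divff ?gt_eqF// mulr1 mulrCA mulrC.
Qed.

(** Layer j, seen as (k, n, i), has a negligible modular for phi even if multiplied
by j + 1, while for phi_ n its modular is at least i + 1 even if divided by i + 1.
The factor 2 ^ (j + 1) is the price that [rho_layers] asks. *)
Definition good_layer (j : nat) (u m : R) : Prop :=
  [/\ 0 < u, 0 < m,
    ((phi (j.+1%:R * u))%:E * ((2 ^+ j.+1)%:E * W m) <=
      (2%:R / (2 ^ j.+1)%:R)%:E)%E &
    forall k n i, unpickle j = Some (k, n, i) :> option (nat * nat * nat) ->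
      (i.+1%:R%:E <= (phi_ n (u / i.+1%:R))%:E * W m)%E].

(** The height u comes from [domination_point] with C = 8 ^ (j+1) (i+1) (j+1) and
b = 1 / (i+1); by convexity the first two factors of C survive as a gain in phi.
The length m makes W(m) equal to (i+1) / phi_ n (u / (i+1)) up to a factor 2. *)
Lemma good_layer_ex j : exists u m, good_layer j u m.
Proof.
have j0 : 0 < j.+1%:R :> R by [].
case dj : (unpickle j : option (nat * nat * nat)) => [[[k n] i]|]; last first.
  have p0 : 0 < phi (j.+1%:R * 1) * 2 ^+ j.+1.
    by rewrite mulr_gt0 ?exprn_gt0// (orlicz_gt0 ophi)// mulr1.
  have y0 : 0 < 2%:R / (2 ^ j.+1)%:R :> R by rewrite divr_gt0// ltr0n expn_gt0.
  have [m m0 Wm] := weight_primitive_small hw (divr_gt0 y0 p0).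
  exists 1, m; split => //; last by rewrite dj.
  rewrite muleA -EFinM.
  apply: (@le_trans _ _ ((phi (j.+1%:R * 1) * 2 ^+ j.+1)%:E *
    (2%:R / (2 ^ j.+1)%:R / (phi (j.+1%:R * 1) * 2 ^+ j.+1))%:E)%E).
    by rewrite lee_pmul2l.
  by rewrite -EFinM lee_fin [leLHS]mulrC divfK ?gt_eqF.
have i0 : 0 < i.+1%:R :> R by [].
have [u u0 Hu] : exists2 u : R, 0 < u &
    phi ((8%:R ^+ j.+1 * i.+1%:R * j.+1%:R) * u) <= phi_ n (i.+1%:R^-1 * u).
  by apply: domination_point; rewrite ?invr_gt0// !mulr_gt0// exprn_gt0.
set P := phi_ n (i.+1%:R^-1 * u) in Hu.
have P0 : 0 < P by rewrite (orlicz_gt0 (ophi_ n))// mulr_gt0// invr_gt0.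
have [m m0 /andP[Wm1 Wm2]] := weight_primitive_approx hw (divr_gt0 i0 P0).
exists u, m; split => //; last first.
  move=> k' n' i'; rewrite dj => -[_ <- <-].
  rewrite [u / _]mulrC -/P; apply: (@le_trans _ _ (P%:E * (i.+1%:R / P)%:E)%E).
    by rewrite -EFinM lee_fin mulrC divfK ?gt_eqF.
  by rewrite lee_pmul2l.
set A := phi (j.+1%:R * u).
have A0 : 0 <= A by rewrite (orlicz_ge0 ophi)// mulr_ge0// ltW.
have AP : 8%:R ^+ j.+1 * i.+1%:R * A <= P.
  apply: le_trans Hu; rewrite -[_ * u]mulrA; apply: (orlicz_expand ophi).
    have h1 : 1 <= 8%:R ^+ j.+1 :> R by rewrite exprn_ege1// ler1n.
    by rewrite -[leLHS]mulr1 ler_pM// ler1n.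
  by rewrite mulr_ge0// ltW.
apply: (@le_trans _ _ (A%:E * ((2 ^+ j.+1)%:E * (2 * (i.+1%:R / P))%:E))%E).
  by rewrite lee_wpmul2l ?lee_fin// lee_pmul2l// lte_fin exprn_gt0.
rewrite -!EFinM lee_fin natrX.
have -> : A * (2 ^+ j.+1 * (2 * (i.+1%:R / P))) =
    (A * i.+1%:R * 2 ^+ j.+1 * 2) / P.
  by rewrite !mulrA; congr (_ / _); ring.
have t1 : 1 <= 2 ^+ j.+1 :> R by rewrite exprn_ege1// ler1n.
have t0 : 0 < 2 ^+ j.+1 :> R by apply: lt_le_trans t1.
rewrite ler_pdivrMr// [leRHS]mulrAC ler_pdivlMr//.
have e8 : 8%:R ^+ j.+1 = 2 ^+ j.+1 * 2 ^+ j.+1 * 2 ^+ j.+1 :> R.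
  by rewrite -!exprMn; congr (_ ^+ _); ring.
rewrite e8 in AP; move: (2 ^+ j.+1) t1 t0 AP => t t1 t0 AP.
have B0 : 0 <= A * i.+1%:R by rewrite mulr_ge0.
have : A * i.+1%:R * t * t <= P.
  apply: le_trans AP; rewrite -[leLHS]mul1r.
  have -> : t * t * t * i.+1%:R * A = t * (A * i.+1%:R * t * t) by ring.
  by rewrite ler_wpM2r// mulr_ge0// ?mulr_ge0// ltW.
by move=> H; nra.
Qed.

Lemma good_layers : exists u m : nat -> R, forall j, good_layer j (u j) (m j).
Proof.
have [f Hf] := choice (fun j => good_layer_ex j).
by have [g Hg] := choice Hf; exists f, g.
Qed.

End selection.

(** * The space of layered functions *)
Section intervals.
Context (R : realType) (m : nat -> R).
Hypothesis m0 : forall j, 0 < m j.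

Definition stacked_itv j : set (lebesgue_line R) :=
  `[\sum_(i < j) m i, \sum_(i < j.+1) m i[%classic : set R.

Let sum_nd i j : (i <= j)%N -> \sum_(k < i) m k <= \sum_(k < j) m k.
Proof.
move=> /subnK <-; elim: (j - i)%N => // k IH; apply: le_trans IH _.
by rewrite addSn big_ord_recr /= lerDl ltW.
Qed.

Lemma measurable_stacked_itv j : measurable (stacked_itv j).
Proof. by apply: sub_caratheodory; exact: measurable_itv. Qed.

Lemma trivIset_stacked_itv : trivIset setT stacked_itv.
Proof.
move=> i j _ _ [t []]; rewrite /stacked_itv /= !in_itv /=.
move=> /andP[it ti] /andP[jt tj]; apply/eqP; rewrite eqn_leq; apply/andP; split.
  rewrite leqNgt; apply/negP => /sum_nd /(lt_le_trans tj) /lt_le_trans /(_ it).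
  by rewrite ltxx.
rewrite leqNgt; apply/negP => /sum_nd /(lt_le_trans ti) /lt_le_trans /(_ jt).
by rewrite ltxx.
Qed.

Lemma mI_stacked_itv j : mI (stacked_itv j) = (m j)%:E.
Proof.
rewrite /mI /mrestr setIidl; last first.
  move=> t; rewrite /stacked_itv /= in_itv /= => /andP[jt _].
  by apply: le_trans jt; apply: sumr_ge0 => i _; exact: ltW.
transitivity (lebesgue_measure
    (`[\sum_(i < j) m i, \sum_(i < j.+1) m i[%classic : set R)).
  by [].
rewrite lebesgue_measure_itv /= lte_fin big_ord_recr /= ltrDl m0 -EFinB.
by congr EFin; rewrite addrAC subrr add0r.
Qed.

End intervals.

Section subspace.
Context (R : realType) (w phi : R -> R) (phi_ : nat -> R -> R).
Hypotheses (hw : weight_function w) (ophi : orlicz_function phi).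
Hypothesis ophi_ : forall n, orlicz_function (phi_ n).
Variables u m : nat -> R.
Hypothesis um : forall j, good_layer w phi phi_ j (u j) (m j).
Notation W := (weight_primitive w).
Notation E := (stacked_itv m).

Let u0 j : 0 < u j. Proof. by case: (um j). Qed.
Let m0 j : 0 < m j. Proof. by case: (um j). Qed.
Let mE := measurable_stacked_itv m.
Let tE := trivIset_stacked_itv m0.

(** The block of a layer (k, n, i) is k: all the layers of a block share one
coefficient.  Numbers that code no triple go to block 0. *)
Definition block (j : nat) : nat :=
  if (unpickle j : option (nat * nat * nat)) is Some (k, _, _) then k else 0%N.

Definition layered (a : nat -> R) : lebesgue_line R -> R :=
  step E (fun j => a (block j) * u j).

Lemma layeredE a j t : E j t -> layered a t = a (block j) * u j.
Proof. by move=> Ejt; rewrite /layered (stepE tE _ Ejt). Qed.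

(** By [rho_layers], up to finitely many terms the modular is dominated by a
geometric series: as soon as 2 K <= j + 1, the bound on layer j applies. *)
Lemma rho_layered_lty (h : lebesgue_line R -> R) (K : R) : 0 <= K ->
  (forall t l, 0 < l -> l < `|h t| -> exists2 j, E j t & l < K * u j) ->
  (rho phi w h < +oo)%E.
Proof.
move=> K0 hK.
have Ku0 j : 0 <= K * u j by rewrite mulr_ge0// ltW.
have mEm j : (mI (E j) <= (m j)%:E)%E by rewrite mI_stacked_itv.
have bound := rho_layers ophi hw Ku0 mEm hK; apply: le_lt_trans bound _.
set f := (fun j => (phi (2 * (K * u j)))%:E * W (2 ^+ j.+1 * m j)%R)%E.
have f0 j : (0 <= f j)%E.
  rewrite mule_ge0 ?(weight_primitive_ge0 hw)// lee_fin.
  by rewrite (orlicz_ge0 ophi)// mulr_ge0.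
pose J := Num.truncn (2 * K).
rewrite (@nneseries_split R f 0 J (fun k _ => f0 k)); apply: lte_add_pinfty.
  apply: lte_sum_pinfty => j _; rewrite lte_mul_pinfty ?lee_fin//.
    by rewrite (orlicz_ge0 ophi)// mulr_ge0.
  exact: weight_primitive_lty.
have two0 : 0 <= 2%:R :> R by [].
have g2 := epsilon_trick0 xpredT two0.
set g := (fun j : nat => (2%:R / (2 ^ j.+1)%:R : R)%:E) in g2.
have g0 j : (0 <= g j)%E by rewrite lee_fin divr_ge0.
apply: (@le_lt_trans _ _ (\sum_(0 + J <= j <oo) g j)%E); last first.
  apply: (@le_lt_trans _ _ 2%:R%:E); last exact: ltry.
  apply: le_trans g2.
  rewrite [leRHS](@nneseries_split R g 0 J (fun k _ => g0 k)) leeDr//.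
  by apply: sume_ge0 => j _; exact: g0.
rewrite add0n -(@nneseries_addn R f J f0) -(@nneseries_addn R g J g0).
apply: lee_nneseries => [i _ _|i _]; first exact: f0.
have : (J <= i + J)%N by rewrite leq_addl.
move: (i + J)%N => j Jj; rewrite /f /g.
have [_ _ + _] := um j; apply: le_trans.
apply: lee_pmul; rewrite ?lee_fin ?(weight_primitive_ge0 hw)//.
- by rewrite (orlicz_ge0 ophi)// mulr_ge0.
- apply: (orlicz_le ophi); first by rewrite mulr_ge0.
  rewrite mulrA ler_pM2r//; apply/ltW; apply: lt_le_trans (truncnS_gt _) _.
  by rewrite ler_nat.
- exact: weight_primitive_pow2.
Qed.

Lemma layered_lin r a b t :
  layered (fun k => r * a k + b k) t = r * layered a t + layered b t.
Proof.
rewrite /layered /step; case: (step_index _ _) => [j|] /=.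
  by rewrite mulrDl mulrA.
by rewrite mulr0 addr0.
Qed.

Definition layered_mfun a : {mfun lebesgue_line R >-> R} :=
  HB.pack (layered a)
    (isMeasurableFun.Build _ _ _ _ (layered a) (measurable_step mE tE _)).

Definition layered_L0 a : L0 R := (\pi_(L0 R) (layered_mfun a))%qT.

Lemma ae_layered_L0 a :
  {ae mI (R := R), forall t, layered_L0 a t = layered a t}.
Proof. exact: (ae_repr_pi (layered_mfun a)). Qed.

(** The coefficients a are arbitrary, not only bounded: this is what makes the
subspace closed. *)
Definition layered_space : set (L0 R) := [set x |
  (exists a, {ae mI (R := R), forall t, x t = layered a t}) /\
  forall K, (rho phi w (fun t => K * x t)%R < +oo)%E].

Lemma layered_space0 : layered_space 0.
Proof.
split.
  exists (fun=> 0); apply: filterS (@ae_0E R) => t ->.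
  by rewrite /layered /step; case: (step_index _ _) => [j|] //=; rewrite mul0r.
move=> K; apply: le_lt_trans (rho_layered_lty (h := fun=> 0) ler01 _).
  apply: (rho_le_ae ophi hw); apply: filterS (@ae_0E R) => t ->.
  by rewrite mulr0.
by move=> t l l0; rewrite normr0 => /(lt_trans l0); rewrite ltxx.
Qed.

Lemma layered_space_lin r (x y : L0 R) :
  layered_space x -> layered_space y -> layered_space (r *: x + y).
Proof.
move=> [[a xa] xK] [[b yb] yK].
have rxy : {ae mI (R := R), forall t, (r *: x + y : L0 R) t = r * x t + y t}.
  by apply: filterS2 (ae_addE (r *: x) y) (ae_scaleE r x) => t -> ->.
split.
  exists (fun k => r * a k + b k); apply: filterS3 rxy xa yb => t -> -> ->.
  by rewrite layered_lin.
move=> K; have H := @rho_add R phi w ophi hw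
  (fun t => K * (r *: x + y : L0 R) t)
  (fun t => K * r * x t) (fun t => K * y t).
apply: le_lt_trans (H _) _.
  by apply: filterS rxy => t ->; rewrite mulrDr mulrA ler_normD.
rewrite lte_mul_pinfty ?lee_fin// lte_add_pinfty//.
  by under [X in rho _ _ X]funext do rewrite mulrA; exact: xK.
by under [X in rho _ _ X]funext do rewrite mulrA; exact: yK.
Qed.

Lemma submod_closed_layered : submod_closed (mem layered_space).
Proof.
split; first exact/mem_set/layered_space0.
move=> r x y /set_mem Mx /set_mem My; apply/mem_set.
exact: layered_space_lin.
Qed.

Lemma layered_space_oc : layered_space `<=` orlicz_lorentz_oc phi w.
Proof.
move=> x [_ xK]; apply: (order_continuous_of_modular ophi hw) => K K0.
by rewrite (modular_scale ophi hw).
Qed.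

Lemma pickle_block (k n i : nat) : block (pickle (k, n, i)) = k.
Proof. by rewrite /block pickleK. Qed.

(** Let a k != 0.  For i large, l |a k| > 1 / (i + 1), so that l x exceeds
u j / (i + 1) on the layer j = (k, n, i), and Chebyshev's inequality bounds the
modular below by i + 1. *)
Lemma layered_space_notin x n : layered_space x -> x != 0 ->
  ~ orlicz_lorentz (phi_ n) w x.
Proof.
move=> [[a xa] _] x0 [l l0]; rewrite (modular_scale (ophi_ n) hw) => xoo.
have [k ak] : exists k, a k != 0.
  apply: contrapT => nex; move/eqP: x0; apply; apply/L0_eqP.
  apply: filterS2 xa (@ae_0E R) => t -> ->.
  rewrite /layered /step; case: (step_index _ _) => [j|] //=.
  have [->|aj] := eqVneq (a (block j)) 0; first by rewrite mul0r.
  by exfalso; apply: nex; exists (block j).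
set r := rho _ _ _ in xoo.
have rfin : r \is a fin_num by rewrite ge0_fin_numE// (rho_ge0 (ophi_ n) hw).
have lak : 0 < l * `|a k| by rewrite mulr_gt0// normr_gt0.
pose i := maxn (Num.truncn (fine r)) (Num.truncn (l * `|a k|)^-1).
have i1 : fine r < i.+1%:R.
  by apply: lt_le_trans (truncnS_gt _) _; rewrite ler_nat ltnS leq_maxl.
have i2 : i.+1%:R^-1 < l * `|a k|.
  rewrite invf_plt ?posrE//; apply: lt_le_trans (truncnS_gt _) _.
  by rewrite ler_nat ltnS leq_maxr.
pose j := pickle (k, n, i).
have [_ _ _ /(_ k n i (pickleK _)) Hj] := um j.
have uji : 0 < u j / i.+1%:R by rewrite divr_gt0.
have dj : ((m j)%:E <= distr (fun t => (l * x t)%R) (u j / i.+1%:R))%E.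
  rewrite -(mI_stacked_itv m0).
  apply: mI_le_ae; apply: filterS xa => t xt Ejt /=.
  rewrite xt (layeredE _ Ejt) pickle_block !normrM.
  rewrite (gtr0_norm l0) (gtr0_norm (u0 j)).
  by rewrite mulrA [ltRHS]mulrC ltr_pM2l.
have := le_trans Hj (rho_chebyshev (ophi_ n) hw uji dj).
by rewrite -/r -(fineK rfin) lee_fin leNgt i1.
Qed.

Lemma layered_approx (f : L0 R) :
  (forall e : R, 0 < e -> exists2 g, layered_space g &
     (luxemburg_norm phi w (f - g)%R < e%:E)%E) ->
  forall p : nat, exists a : nat -> R,
    (distr (fun t => (f t - layered a t)%R) (2^-1 ^+ p) <= (2^-1 ^+ p)%:E)%E.
Proof.
move=> fM p; have p0 : 0 < 2^-1 ^+ p :> R by rewrite exprn_gt0// invr_gt0.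
have [e e0 eP] := luxemburg_distr ophi hw p0 p0.
have [g [[a ga] _] fg] := fM e e0; exists a; apply: le_trans (eP _ fg).
apply: mI_le_ae; apply: filterS3 (ae_addE f (- g)) (ae_oppE g) ga => t.
by move=> E1 E2 E3 /=; rewrite -E3 -E2 -E1.
Qed.

(** On one chosen layer jk k of each block k, the coefficients of the approximants
form intervals of radius e p / u (jk k) that pairwise intersect; their common point
is the coefficient b k.  The other layers of the block follow since their
coefficients are the same. *)
Lemma layered_limit (f : L0 R) :
  (forall p : nat, exists a : nat -> R,
    (distr (fun t => (f t - layered a t)%R) (2^-1 ^+ p) <= (2^-1 ^+ p)%:E)%E) ->
  exists a, {ae mI (R := R), forall t, f t = layered a t}.
Proof.
move=> /choice[a fa]; pose e p : R := 2^-1 ^+ p.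
have e0 p : 0 < e p by rewrite exprn_gt0// invr_gt0.
have e_small (d : R) : 0 < d -> exists P, forall p, (P <= p)%N -> e p < d.
  move=> d0.
  have /cvgr0Pnorm_lt/(_ _ d0)[P _ HP] : (fun p => e p) @ \oo --> (0 : R).
    by apply: cvg_expr; rewrite ger0_norm ?invr_ge0// invf_lt1// ltr1n.
  by exists P => p /HP /=; rewrite ger0_norm// ltW.
pose jk (k : nat) := pickle (k, 0%N, 0%N).
(* Otherwise every point of the layer would lie in one of the two exceptional
   sets, which together are too small to cover it. *)
have close k p q : e p + e q < m (jk k) ->
    `|a p k - a q k| * u (jk k) <= e p + e q.
  move=> epq; rewrite leNgt; apply/negP => apq.
  suff : ((m (jk k))%:E <= (e p)%:E + (e q)%:E)%E.
    by rewrite -EFinD lee_fin leNgt epq.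
  rewrite -(mI_stacked_itv m0); apply: le_trans (leeD (fa p) (fa q)).
  apply: le_trans (mI_U _ _); apply: mI_le => t Et /=.
  rewrite !(layeredE _ Et) pickle_block.
  have [|fp] := ltP (e p) `|f t - a p k * u (jk k)|; first by left.
  right; rewrite ltNge; apply/negP => fq.
  move: apq; rewrite ltNge => /negP; apply.
  rewrite -(gtr0_norm (u0 (jk k))) -normrM mulrBl.
  have -> : a p k * u (jk k) - a q k * u (jk k) =
    - (f t - a p k * u (jk k)) + (f t - a q k * u (jk k)) by ring.
  by apply: le_trans (ler_normD _ _) _; rewrite normrN lerD.
have lim k : exists b, exists P, forall p, (P <= p)%N ->
    `|a p k - b| * u (jk k) <= e p.
  have [P HP] := e_small (m (jk k) / 2) (divr_gt0 (m0 _) (ltr0n R 2)).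
  have [|b Hb] := @interval_helly R (fun p => a p k)
    (fun p => e p / u (jk k)) P.
    move=> p q /HP ep /HP eq.
    have epq : e p + e q < m (jk k) by lra.
    have := close k p q epq; rewrite -ler_pdivlMr// mulrDl => H.
    by have := le_trans (ler_norm _) H; lra.
  by exists b, P => p Pp; rewrite -ler_pdivlMr//; exact: Hb.
have [b bP] := choice lim.
exists b.
have near_b (o : option nat) : exists2 C, 0 <= C & exists P, forall p,
    (P <= p)%N -> forall t, step_index E t = o ->
    `|layered (a p) t - layered b t| <= C * e p.
  case: o => [j|]; last first.
    exists 0 => //; exists 0%N => p _ t tj.
    by rewrite /layered /step tj /= subrr normr0 mul0r.
  have [P HP] := bP (block j).
  exists (u j / u (jk (block j))); first by rewrite divr_ge0// ltW.
  exists P => p /HP H t /(step_indexP tE) Ejt.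
  rewrite !(layeredE _ Ejt) -mulrBl normrM (gtr0_norm (u0 j)) mulrC -mulrA.
  by rewrite ler_pM2l// mulrC ler_pdivlMr.
have null (o : option nat) (n : nat) :
    {ae mI (R := R), forall t, step_index E t = o ->
      `|f t - layered b t| <= n.+1%:R^-1}.
  pose S : set (lebesgue_line R) :=
    [set t | step_index E t = o /\ n.+1%:R^-1 < `|f t - layered b t|].
  have S0 : mI S = 0%E.
    apply/eqP; rewrite eq_le measure_ge0 andbT.
    apply/lee_addgt0Pr => d d0; rewrite add0e.
    have [C C0 [P HP]] := near_b o.
    have [Q HQ] := e_small d d0.
    have n0 : 0 < n.+1%:R^-1 / (C + 1) :> R by rewrite divr_gt0// ltr_wpDl.
    have [Q' HQ'] := e_small _ n0.
    pose p := maxn P (maxn Q Q').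
    have Pp : (P <= p)%N by rewrite leq_maxl.
    have Qp : (Q <= p)%N by rewrite /p maxnCA leq_maxl.
    have Qp' : (Q' <= p)%N by rewrite /p maxnA leq_maxr.
    apply: (@le_trans _ _ (e p)%:E); last by rewrite lee_fin ltW// HQ.
    apply: le_trans (fa p); apply: mI_le => t [to ft] /=.
    have := HQ' p Qp'.
    rewrite ltr_pdivlMr ?ltr_wpDl// mulrDr mulr1 [e p * C]mulrC.
    have := HP p Pp t to; rewrite -/(e p) => H1 H2.
    have H3 : `|f t - layered b t| <=
        `|f t - layered (a p) t| + `|layered (a p) t - layered b t|.
      have -> : f t - layered b t =
        (f t - layered (a p) t) + (layered (a p) t - layered b t).
        by ring.
      exact: ler_normD.
    have H4 := lt_le_trans (lt_trans H2 ft) H3; rewrite -/(e p).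
    rewrite -(ltrD2l (C * e p)); apply: lt_le_trans H4 _.
    by rewrite addrC lerD2r.
  have mS : measurable S.
    apply: measurableI; first exact: measurable_step_index.
    have mf : measurable_fun setT (f : lebesgue_line R -> R) by [].
    have mfb : measurable_fun setT (fun t => `|f t - layered b t|).
      have msub : measurable_fun setT (f \- layered b).
        by apply: measurable_funB mf _; exact: measurable_step mE tE _.
      exact: measurableT_comp msub.
    have := mfb measurableT _ (measurable_itv `]n.+1%:R^-1, +oo[).
    rewrite setTI; congr measurable; apply/seteqP; split=> t /=.
      by rewrite in_itv /= andbT.
    by rewrite in_itv /= andbT.
  exists S; split=> // t /= /not_implyP[to /negP]; rewrite -ltNge => lt.
  by split.
have /ae_foralln := fun n =>
  ae_foralln (fun k => null (odflt None (unpickle k)) n).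
apply: filterS => t Ht; apply/eqP.
rewrite -subr_eq0 -normr_le0 leNgt; apply/negP => d0.
have [n _ /(_ n (leqnn n)) /= nd] := near_infty_natSinv_lt (PosNum d0).
have := Ht n (pickle (step_index E t)); rewrite pickleK => /(_ erefl).
by rewrite leNgt nd.
Qed.

Lemma layered_space_approx (f : L0 R) :
  (forall e : R, 0 < e -> exists2 g, layered_space g &
     (luxemburg_norm phi w (f - g)%R < e%:E)%E) -> layered_space f.
Proof.
move=> fM; split; first exact/layered_limit/layered_approx.
move=> K; pose e : R := (`|2 * K| + 1)^-1.
have e0 : 0 < e by rewrite invr_gt0 ltr_wpDl.
have [g [_ gK] fg] := fM e e0.
have H := @rho_add R phi w ophi hw (fun t => K * f t)
  (fun t => K * (f - g : L0 R) t) (fun t => K * g t).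
apply: le_lt_trans (H _) _.
  apply: filterS2 (ae_addE f (- g)) (ae_oppE g) => t E1 E2.
  apply: le_trans (ler_normD _ _).
  by rewrite -mulrDr E1 E2 subrK.
rewrite lte_mul_pinfty ?lee_fin// lte_add_pinfty//.
  under [X in rho _ _ X]funext do rewrite mulrA.
  apply: (@le_lt_trans _ _ 1%E); last exact: ltry.
  by apply: (luxemburg_lt_modular ophi hw fg); rewrite invrK lerDl.
by under [X in rho _ _ X]funext do rewrite mulrA; exact: gK.
Qed.

Lemma layered_space_closed (X : set (L0 R)) :
  norm_closed_in (luxemburg_norm phi w) X layered_space.
Proof. by move=> f _; exact: layered_space_approx. Qed.

(** Otherwise the layer (k, 0, 0) would be a null set. *)
Lemma layered_L0_inj a b : layered_L0 a = layered_L0 b -> a =1 b.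
Proof.
move=> /L0_eqP ab k; pose j : nat := pickle (k, 0%N, 0%N).
apply: contrapT => abk.
have : (mI (E j) <= @mI R set0)%E.
  apply: mI_le_ae.
  apply: filterS3 ab (ae_layered_L0 a) (ae_layered_L0 b) => t E1 E2 E3 Ejt.
  have Eab : layered a t = layered b t by rewrite -E2 -E3 E1.
  rewrite !(layeredE _ Ejt) pickle_block in Eab.
  by case: abk; exact: (mulIf (lt0r_neq0 (u0 j)) Eab).
by rewrite measure0 (mI_stacked_itv m0) lee_fin leNgt m0.
Qed.

Lemma layered_L0_lin r a b :
  layered_L0 (fun k => r * a k + b k) = r *: layered_L0 a + layered_L0 b.
Proof.
apply/L0_eqP.
have H1 := ae_addE (r *: layered_L0 a) (layered_L0 b).
have H2 := ae_scaleE r (layered_L0 a).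
have H3 := ae_layered_L0 (fun k => r * a k + b k).
apply: filterS3 H3 (filterI H1 H2)
  (filterI (ae_layered_L0 a) (ae_layered_L0 b)).
by move=> t E0 [E1 E2] [E3 E4]; rewrite E0 E1 E2 E3 E4 layered_lin.
Qed.

Lemma layered_L0_0 : layered_L0 (fun=> 0) = 0.
Proof.
apply/L0_eqP; apply: filterS2 (ae_layered_L0 (fun=> 0)) (@ae_0E R) => t -> ->.
by rewrite /layered /step; case: (step_index _ _) => [j|] //=; rewrite mul0r.
Qed.

Lemma layered_L0_bounded a :
  (forall k, `|a k| <= 1) -> layered_space (layered_L0 a).
Proof.
move=> a1; split; first by exists a; exact: ae_layered_L0.
move=> K; have H : (rho phi w (fun t => K * layered a t)%R < +oo)%E.
  apply: (rho_layered_lty (normr_ge0 K)) => t l l0; rewrite /layered /step.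
  case tj : (step_index E t) => [j|] /=; last first.
    by rewrite mulr0 normr0 => /(lt_trans l0); rewrite ltxx.
  move=> lt; exists j; first exact/(step_indexP tE).
  apply: lt_le_trans lt _; rewrite !normrM (gtr0_norm (u0 j)).
  by rewrite ler_wpM2l// ler_piMl// ltW.
apply: le_lt_trans H; apply: (rho_le_ae ophi hw).
by apply: filterS (ae_layered_L0 a) => t ->.
Qed.

(** [contract] maps the reals injectively into [-1, 1], which keeps the powers
bounded. *)
Definition power_layered (x : R) : L0 R :=
  layered_L0 (fun k => contract x%:E ^+ k).

Lemma power_layered_in x : layered_space (power_layered x).
Proof.
by apply: layered_L0_bounded => k; rewrite normrX exprn_ile1// contract_le1.
Qed.

Lemma power_layered_inj : injective power_layered.
Proof.
move=> x y /layered_L0_inj /(_ 1%N); rewrite !expr1 => /(@contract_inj R).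
by case.
Qed.

(** A linear combination is the layered function of the combined coefficients; if it
vanishes, so do all the power sums, and [power_sums_eq0] applies. *)
Lemma power_layered_independent : lin_independent (range power_layered).
Proof.
move=> s c us sV.
have exr v : exists x, v \in s -> power_layered x = v.
  have [/sV[x _ <-]|_] := boolP (v \in s); first by exists x.
  by exists 0.
have [r rP] := choice exr.
have sumE : \sum_(v <- s) c v *: v =
    layered_L0 (fun k => \sum_(v <- s) c v * contract (r v)%:E ^+ k).
  elim: s {us sV exr} rP => [|v s IH] rP.
    rewrite big_nil -layered_L0_0; congr layered_L0; apply/funext => k.
    by rewrite big_nil.
  rewrite big_cons IH; last by move=> z zs; apply: rP; rewrite inE zs orbT.
  rewrite -{2}(rP v) ?inE ?eqxx// -layered_L0_lin; congr layered_L0.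
  by apply/funext => k; rewrite big_cons.
rewrite sumE -layered_L0_0 => /layered_L0_inj sum0.
apply: (@power_sums_eq0 _ _ s (fun v => contract (r v)%:E) c us) => //.
by move=> v z vs zs /(@contract_inj R)[rvz]; rewrite -(rP v)// rvz rP.
Qed.

End subspace.

(** * Subspaces of the Orlicz-Lorentz space *)
Section ambient.
Context (R : realType) (w phi : R -> R).
Hypotheses (hw : weight_function w) (ophi : orlicz_function phi).

Lemma orlicz_lorentz_lin r (x y : L0 R) : orlicz_lorentz phi w x ->
  orlicz_lorentz phi w y -> orlicz_lorentz phi w (r *: x + y).
Proof.
move=> [a a0]; rewrite (modular_scale ophi hw) => xa.
move=> [b b0]; rewrite (modular_scale ophi hw) => yb.
pose k := Num.min (a / (2 * (`|r| + 1))) (b / 2).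
have r1 : 0 < 2 * (`|r| + 1) by rewrite mulr_gt0// ltr_wpDl.
have k0 : 0 < k by rewrite lt_min !divr_gt0.
exists k; first exact: k0.
rewrite (modular_scale ophi hw).
have H := @rho_add R phi w ophi hw (fun t => k * (r *: x + y : L0 R) t)
  (fun t => k * r * x t) (fun t => k * y t).
apply: le_lt_trans (H _) _.
  apply: filterS2 (ae_addE (r *: x) y) (ae_scaleE r x) => t -> ->.
  by rewrite mulrDr mulrA ler_normD.
apply: lte_mul_pinfty; [by rewrite lee_fin|by []|apply: lte_add_pinfty].
  apply: le_lt_trans xa; apply: (rho_le_ae ophi hw); apply: nearW => t.
  rewrite !mulrA !normrM ler_wpM2r//.
  rewrite (gtr0_norm a0) (gtr0_norm k0) (ger0_norm (ler0n _ _)).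
  have : k * (2 * (`|r| + 1)) <= a by rewrite -ler_pdivlMr// ge_min lexx.
  by have := normr_ge0 r; move: k0; nra.
apply: le_lt_trans yb; apply: (rho_le_ae ophi hw); apply: nearW => t.
rewrite !mulrA !normrM ler_wpM2r//.
rewrite (gtr0_norm b0) (gtr0_norm k0) (ger0_norm (ler0n _ _)).
by rewrite mulrC -ler_pdivlMr// ge_min lexx orbT.
Qed.

Lemma submod_closed_orlicz_lorentz (x : L0 R) : orlicz_lorentz phi w x ->
  submod_closed (mem (orlicz_lorentz phi w)).
Proof.
move=> Lx; split.
  apply/mem_set; have := orlicz_lorentz_lin (-1) Lx Lx.
  by rewrite scaleN1r addNr.
move=> r y z /set_mem Ly /set_mem Lz; apply/mem_set; exact: orlicz_lorentz_lin.
Qed.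

End ambient.

Theorem theorem4p6 (R : realType) (w : R -> R) (phi : R -> R)
    (phi_ : nat -> R -> R)
    (hw : weight_function w)
    (hphi : orlicz_function phi)
    (hphi_ : forall n, orlicz_function (phi_ n))
    (hDelta : forall n,
      Delta_rel_zero phi (phi_ n) \/ Delta_rel_infty phi (phi_ n)) :
  spaceable (luxemburg_norm phi w) (orlicz_lorentz_oc phi w)
    (orlicz_lorentz_oc phi w `\` \bigcup_n orlicz_lorentz (phi_ n) w)
    [set: R]
  /\
  (Delta2 phi ->
   maximal_spaceable (luxemburg_norm phi w) (orlicz_lorentz phi w)
     (orlicz_lorentz phi w `\` \bigcup_n orlicz_lorentz (phi_ n) w)).
Proof.
have [u [m um]] := good_layers hw hphi hphi_ hDelta.
pose M := layered_space w phi u m.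
have sM : submod_closed (mem M) := submod_closed_layered hw hphi um.
have iV := @power_layered_independent _ _ _ _ u m um.
have VM : range (power_layered um) `<=` M.
  by move=> _ [x _ <-]; exact: (power_layered_in hw hphi um).
have Moc : M `<=` orlicz_lorentz_oc phi w.
  exact: layered_space_oc hw hphi _ _.
have MX : M `<=` orlicz_lorentz phi w by move=> x /Moc[].
have card_continuum (B : set (L0 R)) : range (power_layered um) `<=` B ->
    (B #= [set: R])%card.
  move=> VB; apply: Cantor_Bernstein.
    by apply: card_le_trans (card_L0 R); exact: card_leT.
  apply: card_le_trans (subset_card_le VB).
  have := inj_card_eq (A := [set: R]) (in2W (power_layered_inj (um := um))).
  by rewrite card_eq_le => /andP[].
have [B hB VB] := hamel_basis_extend sM VM iV.
have outside (X : set (L0 R)) : M `<=` X ->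
    M `<=` (X `\` \bigcup_n orlicz_lorentz (phi_ n) w) `|` [set 0].
  move=> MsubX x Mx; have [->|x0] := eqVneq x 0; [by right|left].
  split; first exact: MsubX.
  by move=> [n _]; exact: (layered_space_notin hw hphi_ um Mx x0).
split.
  exists M; split => //.
  - exact: layered_space_closed.
  - by exists B => //; exact: card_continuum.
  - exact: outside.
move=> _.
have sX := submod_closed_orlicz_lorentz hw hphi (MX _ (VM _ (imageT _ 0))).
have [D hD VD] := hamel_basis_extend sX (subset_trans VM MX) iV.
exists D => //; exists M; split => //.
- exact: layered_space_closed.
- exists B => //; apply: card_eq_trans (card_continuum _ VB) _.
  by rewrite card_eq_sym; exact: card_continuum.
- exact: outside.
Qed.
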